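(* Let $G=\mathrm{PSL}_2(q)$, where $q$ is a power of $2$. For a positive integer $m$, let $\varphi(m)$ denote the number of integers in $[1,m]$ coprime to $m$, and let $\tau(m)$ denote the number of positive divisors of $m$. Define $A=\{\,2<d\le q+1 : d\mid q+1\,\}$ and $B=\{\,2<d\le q-1 : d\mid q-1\,\}$. Then the following statements hold. (1) There is a unique trivial $\mathbb{Q}G$-module of dimension $1$. (2) There is a unique (up to isomorphism) Steinberg $\mathbb{Q}G$-module of dimension $q$. (3) For each $d\in A$, there exists a unique (up to isomorphism) simple $\mathbb{Q}G$-module of dimension $\frac{q-1}{2}\varphi(d)$, and these modules are pairwise non-isomorphic for distinct $d$. (4) For each $d\in B$, there exists a unique (up to isomorphism) simple $\mathbb{Q}G$-module of dimension $\frac{q+1}{2}\varphi(d)$, and these modules are pairwise non-isomorphic for distinct $d$. (5) $|\mathrm{Irr}_{\mathbb{Q}}(G)|=\tau(q-1)+\tau(q+1)$.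
   Context: $\mathrm{SL}_2(q)$ is the group of $2\times2$ matrices of determinant $1$ over the finite field $\mathbb{F}_q$, and $\mathrm{PSL}_2(q)=\mathrm{SL}_2(q)/Z(\mathrm{SL}_2(q))$. $\mathrm{Irr}_{\mathbb{Q}}(G)$ denotes the set of irreducible rational characters of $G$, i.e. characters afforded by irreducible representations of $G$ over $\mathbb{Q}$ (equivalently, isomorphism classes of simple $\mathbb{Q}G$-modules). A Steinberg $\mathbb{Q}G$-module is a simple $\mathbb{Q}G$-module affording the Steinberg character, the irreducible complex character of degree $q$ of $G$. Dimensions are over $\mathbb{Q}$.
   Formalization: In (3),(4) uniqueness by dimension alone is false (q=64: φ(7)=φ(9); q=2: trivial and sign), so it is read as: one simple module per d, pairwise non-isomorphic, and every simple module of such a dimension is one of these (or, in (3), the trivial module, possible only for q=2). *)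

(* Defs.v *)
From HB Require Import structures.
From mathcomp Require Import all_boot all_order all_fingroup all_algebra.
From mathcomp Require Import all_solvable all_field all_character.
Set Implicit Arguments.
Unset Strict Implicit.
Unset Printing Implicit Defensive.
Import GroupScope GRing.Theory Num.Theory.
Local Open Scope ring_scope.

Section PSL2.
Variable F : finFieldType.

Definition SL2 : {set {'GL_2[F]}} := [set g | \det (GLval g) == 1].

Lemma SL2_group_set : group_set SL2.
Proof.
apply/group_setP; split=> [|x y]; first by rewrite inE GL_1E det1.
by rewrite !inE => /eqP dx /eqP dy; rewrite GL_MxE det_mulmx dx dy mulr1.
Qed.

Canonical SL2_group := Group SL2_group_set.

Definition PSL2 : {group coset_of 'Z(SL2)} := (SL2 / 'Z(SL2))%G.
End PSL2.

Section QGModules.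
Variables (gT : finGroupType) (G : {group gT}).

(* A QG-module of finite dimension, given by its matrices in a basis. *)
Record QGmodule := QGModule {
  qdim : nat;
  qrep :> mx_representation rat G qdim
}.

Implicit Types M N : QGmodule.

Definition qsimple M : Prop := mx_irreducible M.

Definition qiso M N : Prop := mx_rsim M N.

Definition qtrivial M : Prop := {in G, forall g, M g = 1%:M}.

(* Characters take their values in algC, which contains the values of all
   complex characters of finite groups. *)
Definition qchar M : 'CF(G) := cfRepr (map_repr (ratr : rat -> algC) M).

Definition Irr_rat (chi : 'CF(G)) : Prop :=
  exists2 M : QGmodule, qsimple M & chi = qchar M.

(* "The" irreducible complex character of degree q: the last clause makes the
   definite article part of the definition. *)
Definition steinberg_char (q : nat) (chi : 'CF(G)) : Prop :=
  [/\ chi \in irr G, chi 1%g = q%:R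
    & forall psi : 'CF(G), psi \in irr G -> psi 1%g = q%:R -> psi = chi].

Definition steinberg_module (q : nat) M : Prop :=
  qsimple M /\ steinberg_char q (qchar M).
End QGModules.

Definition setA (q : nat) : pred nat :=
  [pred d | (2 < d <= q + 1)%N && (d %| q + 1)%N].

Definition setB (q : nat) : pred nat :=
  [pred d | (2 < d <= q - 1)%N && (d %| q - 1)%N].

Definition dimA (q d : nat) : rat := (q%:R - 1) / 2%:R * (totient d)%:R.

Definition dimB (q d : nat) : rat := (q%:R + 1) / 2%:R * (totient d)%:R.

Definition tau (m : nat) : nat := size (divisors m).

(* Main.v *)
Require Import Defs.
From Stdlib Require Import Classical_Prop.
From mathcomp Require Import zify ring.
From HB Require Import structures.
From mathcomp Require Import all_boot all_order all_fingroup all_algebra.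
From mathcomp Require Import all_solvable all_field all_character.
Set Implicit Arguments.
Unset Strict Implicit.
Unset Printing Implicit Defensive.
Import GroupScope GRing.Theory Num.Theory.
Local Open Scope ring_scope.

(* G = SL_2(q), q even, has self-centralizing subgroups U (elementary abelian of
   order q, with all involutions conjugate), T and C (cyclic of order q - 1 and
   q + 1, with g and g^-1 the only conjugates of g in the torus), and the conjugates
   of U, T and C meet trivially.  Let mu be a nontrivial linear character of U; it
   has values 1 and -1.  Put Gamma = Ind mu, and let lambda be a faithful linear
   character of a torus.  Restricting induced characters to U, T and C gives their
   scalar products, and these show that the nontrivial irreducible characters are
     Gamma - Ind_C lambda^j  (q + 1 not dividing j),
     Gamma - Ind_C 1 + 1  (the Steinberg character),
     Ind_T lambda^j - Gamma  (q - 1 not dividing j),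
   equal only for exponents j and - j; the sum of the squares of their degrees shows
   that there are no others.  Each of them occurs once in Gamma, which is afforded
   over Q, so its Schur index is 1 and the simple QG-modules afford exactly the sums
   over Galois orbits.  An orbit consists of the characters whose exponent j has a
   given order d modulo q + 1 or q - 1. *)

(** * Rational modules and Galois orbits *)

(** The descent to the rationals rests on two facts: a nonzero scalar product of characters forces
    simple rational modules to be isomorphic, and a simple module containing one member of a Galois
    orbit exactly once must afford the whole orbit sum. A single rational module [Gamma] of
    multiplicity one thus settles almost all orbits at once; the trivial character is its own
    module. Evenness of q enters through the bijectivity of squaring. It makes the identity the only
    scalar matrix of determinant 1, lets any nonzero determinant be normalized by a scalar factor,
    and keeps involutions out of both tori. Conjugacy then reduces to traces, because a nontrivial
    element is conjugate to the companion matrix of its characteristic polynomial. U, T and C are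
    the centralizers of companion matrices whose polynomial has one, two or no roots in the field (T
    being trivial when q = 2). The Steinberg and trivial characters sit at exponent 0 of the two
    families, that is at d = 1. The divisors 1, which A and B leave out, thus account for exactly
    these two modules, and the total is the number of all divisors of q + 1 and q - 1. *)

Lemma mulmx_delta_mulmx (R : comNzRingType) m n p r (A : 'M[R]_(m, n)) (B : 'M_(p, r))
    i j k l :
  (A *m delta_mx i j *m B) k l = A k i * B j l.
Proof.
rewrite mxE (bigD1 j) //= big1 ?addr0 => [|j' /negPf nj].
  rewrite mxE (bigD1 i) //= big1 ?addr0 ?mxE ?eqxx ?mulr1 // => i' /negPf ni.
  by rewrite mxE ni mulr0.
by rewrite mxE big1 ?mul0r // => i' _; rewrite mxE nj andbF mulr0.
Qed.

Section RationalModules.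
Variables (gT : finGroupType) (G : {group gT}).
Implicit Types M N : QGmodule G.

Lemma qcharE M g : g \in G -> qchar M g = ratr (\tr (M g)).
Proof. by move=> Gg; rewrite cfunE Gg mulr1n -trace_map_mx. Qed.

Lemma qchar1 M : qchar M 1%g = (qdim M)%:R.
Proof. exact: cfRepr1. Qed.

Lemma qchar_char M : qchar M \is a character.
Proof. exact: cfRepr_char. Qed.

Lemma cfAut_qchar (u : {rmorphism algC -> algC}) M : cfAut u (qchar M) = qchar M.
Proof. by apply/cfun_inP=> g Gg; rewrite cfunE !qcharE // fmorph_rat. Qed.

Lemma qiso_qchar M N : qiso M N -> qchar M = qchar N.
Proof.
case=> B eqd freeB hom; apply: cfRepr_sim.
by exists (map_mx ratr B); rewrite ?row_free_map // => g Gg;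
   rewrite !map_reprE -!map_mxM hom.
Qed.

Lemma qdim_gt0 M : qsimple M -> (0 < qdim M)%N.
Proof. by case/mx_irrP. Qed.

Lemma hom_average M N (X : 'M_(qdim M, qdim N)) h : h \in G ->
  M h *m (\sum_(g in G) M g^-1%g *m X *m N g) =
  (\sum_(g in G) M g^-1%g *m X *m N g) *m N h.
Proof.
move=> Gh; rewrite mulmx_suml mulmx_sumr [LHS](reindex_inj (mulIg h)) /=.
apply: eq_big => [g | g Ggh]; first by rewrite groupMr.
have Gg: g \in G by rewrite -(groupMr _ Gh).
rewrite invMg !repr_mxM ?groupV // !mulmxA -(repr_mxM _ Gh) ?groupV //.
by rewrite mulgV repr_mx1 mul1mx.
Qed.

Lemma Schur_qiso M N (H : 'M_(qdim M, qdim N)) : qsimple M -> qsimple N ->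
  (forall g, g \in G -> M g *m H = H *m N g) -> H != 0 -> qiso M N.
Proof.
move=> /mx_irrP[_ irrM] /mx_irrP[_ irrN] homH nzH.
have kerH0: kermx H = 0.
  apply/eqP; apply: contraR nzH => nz.
  have: row_full (kermx H).
    apply: irrM nz; apply/mxmoduleP=> g Gg.
    by apply/sub_kermxP; rewrite -mulmxA homH // mulmxA mulmx_ker mul0mx.
  by rewrite -sub1mx => /sub_kermxP; rewrite mul1mx => ->.
have freeH: row_free H by rewrite -kermx_eq0 kerH0.
have fullH: row_full H.
  have: row_full <<H>>%MS.
    apply: irrN; last by rewrite -mxrank_eq0 genmxE mxrank_eq0.
    apply/mxmoduleP=> g Gg; rewrite (eqmxMr _ (genmxE _)) genmxE -homH //.
    exact: submxMl.
  by rewrite /row_full genmxE.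
have eqd: qdim M = qdim N by rewrite -(eqP freeH) (eqP fullH).
by exists H.
Qed.

(* Averaging an elementary matrix over [G] gives a homomorphism [M -> N]; if [M]
   and [N] are not isomorphic it vanishes, and its entries are the orthogonality
   relations over [rat] between matrix coefficients of [M] and [N]. *)
Lemma qiso_cfdot M N : qsimple M -> qsimple N ->
  '[qchar M, qchar N] != 0 -> qiso M N.
Proof.
move=> simM simN nz.
pose A (X : 'M_(qdim M, qdim N)) := \sum_(g in G) M g^-1%g *m X *m N g.
have [nzX | ] := altP (@forallP _ (fun ij => A (delta_mx ij.1 ij.2) == 0)).
  case/eqP: nz; rewrite cfdotE; apply/eqP; rewrite mulf_eq0; apply/orP; right.
  have -> : \sum_(g in G) qchar M g * (qchar N g)^* =
            ratr (\sum_(g in G) \tr (M g^-1%g) * \tr (N g)) :> algC.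
    rewrite raddf_sum (reindex_inj invg_inj) /=.
    apply: eq_big => [g | g]; rewrite groupV // => Gg.
    by rewrite rmorphM /= -!qcharE ?groupV // -char_inv ?qchar_char // invgK.
  rewrite fmorph_eq0; apply/eqP.
  transitivity (\sum_i \sum_j (A (delta_mx i j)) i j); last first.
    by rewrite big1 // => i _; rewrite big1 // => j _; rewrite (eqP (nzX (i, j))) mxE.
  under [RHS]eq_bigr do under eq_bigr do rewrite summxE.
  under [RHS]eq_bigr do rewrite exchange_big /=.
  rewrite exchange_big /=; apply: eq_bigr => g Gg.
  rewrite mulr_suml; apply: eq_bigr => i _; rewrite mulr_sumr.
  by apply: eq_bigr => j _; rewrite mulmx_delta_mulmx.
rewrite negb_forall => /existsP[[i j] /= nzA]; apply: (Schur_qiso simM simN _ nzA).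
by move=> g Gg; apply: hom_average.
Qed.

(** Multiplicities are natural numbers that add over a submodule and its quotient, so the value 1
    passes to exactly one of them, and the dimension drops. *)
Lemma qsimple_constt M (chi : 'CF(G)) : chi \in irr G -> '[qchar M, chi] = 1 ->
  exists2 N : QGmodule G, qsimple N & '[qchar N, chi] = 1.
Proof.
case/irrP=> i ->; have [n] := ubnP (qdim M).
elim: n M => // n IHn M lt_M_n Mchi.
have Mgt0: (0 < qdim M)%N.
  rewrite lt0n; apply/eqP=> M0; move/eqP: Mchi.
  suff ->: qchar M = 0 by rewrite cfdot0l eq_sym oner_eq0.
  by apply/eqP; rewrite -char1_eq0 ?qchar_char // qchar1 M0.
(* The existence of a proper submodule is a plain proposition, decided classically. *)
have [simM | nsimM] := classic (mxnonsimple M 1%:M); last first.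
  exists M => //; apply/mxsimpleP; split=> //; first exact: mxmodule1.
  by rewrite -mxrank_eq0 mxrank1 -lt0n.
have [U /and4P[modU _ nzU]] := simM; rewrite mxrank1 => ltUM.
pose M1 := QGModule (submod_repr modU); pose M2 := QGModule (factmod_repr modU).
have defM: qchar M = qchar M1 + qchar M2.
  apply/cfun_inP=> g Gg; transitivity (qchar M1 g + qchar M2 g); last by rewrite [RHS]cfunE.
  by rewrite !qcharE //= -rmorphD -(mxtrace_sub_fact_mod modU).
have [/natrP[a Da] /natrP[b Db]] : '[qchar M1, 'chi_i] \in Num.nat
  /\ '[qchar M2, 'chi_i] \in Num.nat.
  by split; apply: Cnat_cfdot_char_irr; apply: qchar_char.
move: Mchi; rewrite defM cfdotDl Da Db -natrD => /eqP.
rewrite pnatr_eq1 => ab1.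
have [a1 | b1] : a = 1%N \/ b = 1%N by case: a b ab1 {Da Db} => [|[|a]] [|[|b]]; auto.
  by apply: (IHn M1); rewrite ?Da ?a1 //= (leq_trans ltUM).
apply: (IHn M2); rewrite ?Db ?b1 //= -ltnS; apply: leq_trans lt_M_n.
by rewrite ltnS mxrank_coker ltn_subrL Mgt0 lt0n mxrank_eq0 nzU.
Qed.

(** The values lie in a Galois number field each of whose automorphisms extends to [algC];
    invariance puts them in the fixed field, the rationals. *)
Lemma Crat_cfAut_fixed (chi : 'CF(G)) x : chi \is a character ->
  (forall u : {rmorphism algC -> algC}, cfAut u chi = chi) -> chi x \in Crat.
Proof.
move=> Nchi chi_u; have [Gx | /cfun0->] := boolP (x \in G); last exact: rpred0.
have [Qn galQn [QnC gQnC [_ _ Qn_g]]] := group_num_field_exists G.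
have [a Da] := Qn_g _ G chi Nchi x (order_dvdG Gx).
have: a \in fixedField 'Gal({:Qn} / 1).
  apply/fixedFieldP=> [|nu gal_nu]; first exact: memvf.
  have [u Du] := gQnC nu; apply: (fmorph_inj QnC).
  by rewrite Du Da -{2}(chi_u u) cfunE.
have /galois_fixedField-> := galQn.
case/vlineP=> c Dc; rewrite -Da Dc alg_num_field fmorph_rat; exact: rpred_rat.
Qed.

Lemma sum_char_inv_cfdot (phi chi : 'CF(G)) : chi \is a character ->
  \sum_(g in G) chi g^-1%g * phi g = #|G|%:R * '[phi, chi].
Proof.
move=> Nchi; rewrite cfdotE mulVKf ?neq0CG //.
by apply: eq_bigr => g Gg; rewrite char_inv // mulrC.
Qed.

(* The Galois orbit sum has rational values, so it defines a central element of
   the rational group algebra; by Schur's lemma it acts invertibly on the simple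
   module [M], while its product with the central idempotent of an irreducible
   character outside the orbit vanishes. *)
Lemma qsimple_orbit (O : {set Iirr G}) (i0 : Iirr G) M : i0 \in O ->
  (forall u i, i \in O -> aut_Iirr u i \in O) ->
  (forall i, i \in O -> exists u, i = aut_Iirr u i0) ->
  '[qchar M, 'chi_i0] = 1 ->
  exists2 N : QGmodule G, qsimple N & qchar N = \sum_(i in O) 'chi_i.
Proof.
move=> Oi0 closO orbO Mi0; pose S := \sum_(i in O) 'chi_i.
have [N simN Ni0] := qsimple_constt (mem_irr i0) Mi0.
exists N => //.
have Ni i : i \in O -> '[qchar N, 'chi_i] = 1.
  case/orbO=> u ->; rewrite aut_IirrE -(cfAut_qchar u N) cfdot_aut_irr Ni0.
  exact: rmorph1.
have NS: S \is a character by apply: rpred_sum => i _; apply: irr_char.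
have S_u (u : {rmorphism algC -> algC}) : cfAut u S = S.
  have autO: aut_Iirr u @: O = O.
    apply/eqP; rewrite eqEcard card_imset ?leqnn ?andbT; last exact: aut_Iirr_inj.
    by apply/subsetP=> _ /imsetP[i Oi ->]; apply: closO.
  rewrite raddf_sum -[in RHS]/(S) /S -[in RHS]autO big_imset /=;
    last by move=> i j _ _ /aut_Iirr_inj.
  by apply: eq_bigr => i _; rewrite aut_IirrE.
have [s Ds] : {s : gT -> rat | forall g, S g = ratr (s g)}.
  have Sg g : exists a, S g == ratr a.
    by have /CratP[a ->] := Crat_cfAut_fixed g NS S_u; exists a.
  by exists (fun g => xchoose (Sg g)) => g; apply/eqP/(xchooseP (Sg g)).
pose E := \sum_(g in G) s g^-1%g *: N g.
have Ds_inv g : ratr (s g^-1%g) = S g^-1%g by rewrite Ds.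
have cEN: centgmx N E.
  apply/centgmxP=> h Gh; rewrite mulmx_suml mulmx_sumr.
  rewrite [RHS](reindex_inj (conjg_inj h)) /=.
  apply: eq_big => [g | g Gg]; first by rewrite groupJr.
  rewrite -scalemxAl -scalemxAr -!repr_mxM ?groupJ //; congr (_ *: N _).
    by apply: (fmorph_inj (@ratr algC)); rewrite /= -!Ds -conjVg cfunJ.
  by rewrite conjgC.
have unitE: map_mx (ratr : rat -> algC) E \in unitmx.
  rewrite map_unitmx; apply: (mx_Schur simN cEN); apply/eqP=> E0.
  (* The trace counts the constituents in [O], each of which occurs once in [N]; it is nonzero,
     hence so is [E]. *)
  have: ratr (\tr E) = #|G|%:R * #|O|%:R :> algC.
    have ->: \tr E = \sum_(g in G) s g^-1%g * \tr (N g).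
      by rewrite linear_sum; apply: eq_bigr => g _; apply: mxtraceZ.
    rewrite rmorph_sum /=.
    under eq_bigr => g Gg do rewrite rmorphM /= Ds_inv -qcharE //.
    rewrite sum_char_inv_cfdot // cfdot_sumr; congr (_ * _).
    by rewrite (eq_bigr (fun=> 1)) // sumr_const.
  rewrite E0 mxtrace0 rmorph0 -natrM; apply/eqP; rewrite eq_sym pnatr_eq0.
  rewrite muln_eq0 negb_or -!lt0n cardG_gt0; apply/card_gt0P.
  by exists i0.
have outO j : j \notin O -> '[qchar N, 'chi_j] = 0.
  move=> notOj; pose E' := \sum_(g in G) 'chi_j g^-1%g *: map_mx ratr (N g).
  (* Collected at [N y], the coefficient of the product is a convolution of ['chi_j] with the
     characters in [O], zero by orthogonality. *)
  have E'E0: E' *m map_mx ratr E = 0.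
    rewrite mulmx_suml; under eq_bigr => g Gg.
      rewrite /E raddf_sum mulmx_sumr (reindex_inj (mulgI g^-1%g)) /=.
      rewrite (eq_bigl (mem G)) => [|y]; last by rewrite groupMl ?groupV.
      under eq_bigr => y Gy.
        rewrite map_mxZ -scalemxAl -scalemxAr scalerA -map_mxM -repr_mxM ?groupM ?groupV //.
        rewrite mulKVg /= Ds_inv invMg invgK; over.
      over.
    rewrite exchange_big /= big1 // => y Gy.
    rewrite -scaler_suml (_ : \sum_(g in G) _ = 0) ?scale0r //.
    under eq_bigr do rewrite mulrC sum_cfunE mulr_suml.
    rewrite exchange_big big1 //= => i Oi.
    have:= generalized_orthogonality_relation y^-1%g i j.
    rewrite (negPf (memPn notOj i Oi)) mul0r => /eqP.
    rewrite mulf_eq0 invr_eq0 (negPf (neq0CG G)) => /eqP E0.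
    rewrite -[RHS]E0; apply: eq_bigr => x Gx.
    by rewrite -(cfunJ _ (y^-1 * x)%g (groupVr Gx)) conjgE invgK -!mulgA mulgV mulg1.
  have E'0: E' = 0 by rewrite -[E'](mulmxK unitE) E'E0 mul0mx.
  have: \tr E' = #|G|%:R * '[qchar N, 'chi_j].
    rewrite linear_sum -sum_char_inv_cfdot ?irr_char //=.
    by apply: eq_bigr => g Gg; rewrite qcharE // -trace_map_mx -mxtraceZ.
  by rewrite E'0 mxtrace0 => /esym/eqP; rewrite mulf_eq0 (negPf (neq0CG G)) => /eqP.
rewrite [LHS]cfun_sum_cfdot (bigID (mem O)) /= [X in _ + X]big1 ?addr0.
  by apply: eq_bigr => i Oi; rewrite Ni ?scale1r.
by move=> i notOi; rewrite outO ?scale0r.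
Qed.

(** [E] factors through coordinates on its row space, so tr (X Y) = tr (Y X) moves the trace from
    the submodule to the whole space. *)
Lemma mxtrace_idempotent_submod (F : fieldType) n (rG : mx_representation F G n)
    (E : 'M_n) (modE : mxmodule rG E) g :
  E *m E = E -> centgmx rG E -> g \in G -> \tr (submod_repr modE g) = \tr (E *m rG g).
Proof.
move=> idE cE Gg; rewrite -[submod_repr modE g]mulmxA mxtrace_mulC -val_submodE.
set P := val_submod _; have DP: P = val_submod (in_submod E (rG g)) by
  rewrite /P /in_submod /= mulmxA.
have PE: P *m E = P.
  by have /submxP[Z ->] : (P <= E)%MS by [exact: val_submodP]; rewrite -mulmxA idE.
have [J [K [EJK DJK]]] : exists (J : 'M_(n, \rank E)) (K : 'M_(\rank E, n)),
    E *m J *m K = E /\ P = rG g *m J *m K.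
  exists (in_submod E 1%:M), (val_submod 1%:M).
  by rewrite DP -!in_submodE -!val_submodE in_submodK.
rewrite -PE mxtrace_mulC DJK !mulmxA (centgmxP cE) //.
by rewrite -!mulmxA (mulmxA E) EJK.
Qed.

(** On the rational group algebra, [E] is left multiplication by the idempotent |H|^-1 sum_h phi(h)
    h^-1. It commutes with right multiplication, and its image is the induced module. *)
Lemma Ind_qmodule (H : {group gT}) (phi : 'CF(H)) : H \subset G ->
  phi \is a linear_char -> (forall x, phi x \in Crat) ->
  exists M : QGmodule G, qchar M = 'Ind[G] phi.
Proof.
move=> sHG Lphi phiQ.
have [p Dp] : {p : gT -> rat | forall x, phi x = ratr (p x)}.
  have Sg x : exists a, phi x == ratr a by have /CratP[a ->] := phiQ x; exists a.
  by exists (fun g => xchoose (Sg g)) => g; apply/eqP/(xchooseP (Sg g)).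
have ratrI := fmorph_inj (@ratr algC).
have p_out x : x \notin H -> p x = 0.
  by move=> notHx; apply: ratrI; rewrite /= -Dp cfun0 // rmorph0.
have pM x y : x \in H -> p (x * y)%g = p x * p y.
  move=> Hx; have [Hy | notHy] := boolP (y \in H).
    by apply: ratrI; rewrite rmorphM /= -!Dp lin_charM.
  by rewrite !(p_out y) ?mulr0 // p_out // groupMl.
have nzH : #|H|%:R != 0 :> rat by rewrite pnatr_eq0 -lt0n cardG_gt0.
pose rG := regular_repr rat G.
pose E : 'M[rat]_#|G| := \matrix_(i, j) (#|H|%:R^-1 * p (enum_val i * (enum_val j)^-1)%g).
have ErG g i j : g \in G -> (E *m rG g) i j = #|H|%:R^-1 * p (enum_val i * g * (enum_val j)^-1)%g.
  move=> Gg; rewrite mxE (bigD1 (gring_index G (enum_val j * g^-1)%g)) //= big1 ?addr0.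
    rewrite !mxE eqxx /= gring_indexK ?groupM ?groupV ?enum_valP //.
    by rewrite mulgKV gring_valK eqxx mulr1 invMg invgK mulgA.
  move=> k nk; rewrite !mxE eqxx /= (_ : (j == _) = false) ?mulr0 //.
  apply: contraNF nk => /eqP->.
  by rewrite gring_indexK ?groupM ?enum_valP // mulgK gring_valK.
have rGE g i j : g \in G -> (rG g *m E) i j = #|H|%:R^-1 * p (enum_val i * g * (enum_val j)^-1)%g.
  move=> Gg; rewrite mxE (bigD1 (gring_index G (enum_val i * g)%g)) //= big1 ?addr0.
    by rewrite !mxE !eqxx mul1r gring_indexK ?groupM ?enum_valP.
  by move=> k /negPf nk; rewrite !mxE eqxx nk mul0r.
have cE : centgmx rG E.
  by apply/centgmxP=> g Gg; apply/matrixP=> i j; rewrite ErG // rGE.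
have idE : E *m E = E.
  apply/matrixP=> i j; rewrite !mxE.
  under eq_bigr do rewrite !mxE.
  rewrite -(big_enum_val (fun z => #|H|%:R^-1 * p (enum_val i * z^-1)%g *
                                   (#|H|%:R^-1 * p (z * (enum_val j)^-1)%g))) /=.
  set a := enum_val i; set b := enum_val j; have Ga: a \in G := enum_valP i.
  rewrite (reindex_inj (inj_comp (mulIg a) invg_inj)) /=.
  under eq_bigl do rewrite groupMr // groupV.
  under eq_bigr do rewrite invMg invgK mulKVg mulrACA -mulgA.
  rewrite -mulr_sumr (big_setID H) /= (setIidPr sHG) [X in _ + X]big1 ?addr0; last first.
    by move=> h; rewrite inE => /andP[notHh _]; rewrite p_out ?mul0r.
  rewrite (eq_bigr (fun=> p (a * b^-1)%g)); last first.
    by move=> h Hh; rewrite -pM // mulKVg.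
  by rewrite sumr_const -(mulr_natl (p _)) mulrACA mulVf // mul1r.
have modE: mxmodule rG E.
  by apply/mxmoduleP=> g Gg; rewrite (centgmxP cE) ?submxMl.
exists (QGModule (submod_repr modE)); apply/cfun_inP=> g Gg.
rewrite qcharE // mxtrace_idempotent_submod // cfIndE //.
under [X in ratr X]eq_bigr do rewrite ErG //.
rewrite rmorph_sum /=.
under eq_bigr do rewrite rmorphM fmorphV rmorph_nat /= -Dp.
rewrite -mulr_sumr -(big_enum_val (fun x => phi (x * g * x^-1)%g)) /=; congr (_ * _).
rewrite (reindex_inj invg_inj) /=; apply: eq_big => [x | x Gx]; first by rewrite groupV.
by rewrite invgK -mulgA.
Qed.

End RationalModules.

Section TrivialModule.
Variables (gT : finGroupType) (G : {group gT}).

Lemma trivial_mx_repr : mx_repr G (fun _ => 1%:M : 'M[rat]_1).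
Proof. by split=> // x y _ _; rewrite mulmx1. Qed.

Definition trivial_module := QGModule (MxRepresentation trivial_mx_repr).

Lemma qiso_trivial N : qtrivial N -> qdim N = 1%N -> qiso N trivial_module.
Proof.
case: N => n rN trivN /= n1; case: _ / (esym n1) in rN trivN *.
by exists 1%:M => // [|x Gx]; rewrite ?row_free_unit ?unitmx1 // trivN.
Qed.

Lemma qtrivial_qiso M : qiso M trivial_module -> qtrivial M.
Proof.
by move=> isoM g Gg; apply: (mx_rsim_scalar Gg (mx_rsim_sym isoM)).
Qed.

Lemma qsimple_trivial : qsimple trivial_module.
Proof. exact/mx_abs_irrW/linear_mx_abs_irr. Qed.

Lemma qchar_trivial : qchar trivial_module = 1.
Proof. by apply/cfun_inP=> g Gg; rewrite qcharE // cfun1E Gg mxtrace1 rmorph1. Qed.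

End TrivialModule.

(** * Residues up to sign *)

Definition eqpm n j k := (j == k %[mod n])%N || (n %| j + k)%N.

Lemma dvdn_modn0 d m : (d %| m)%N -> (m %% d)%N = 0%N.
Proof. by move/eqP. Qed.

(** Both congruences hold together only if [n] divides 2j, hence, [n] being odd, both [j] and [k];
    the product accounts for this double count. *)
Lemma eqpm_count n j k : odd n ->
  (((j == k %[mod n]) + (n %| j + k) = eqpm n j k + (n %| j) * (n %| k)))%N.
Proof.
move=> oddn; rewrite /eqpm.
have cop : coprime n 2 by rewrite coprime_sym coprime2n.
case e1: (j == k %[mod n]); case e2: (n %| j + k)%N => /=; apply/eqP; rewrite ?eqSS.
- have nj : (n %| j)%N.
    rewrite -(Gauss_dvdl _ cop) muln2 -addnn /dvdn -modnDmr (eqP e1) modnDmr; exact: e2.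
  have nk : (n %| k)%N by rewrite -(dvdn_addr _ nj).
  by rewrite nj nk.
- case nj: (n %| j)%N => //; case nk: (n %| k)%N => //.
  by rewrite dvdn_addr // nk in e2.
- case nj: (n %| j)%N => //; case nk: (n %| k)%N => //.
  by move: e1; rewrite (eqP nj) (eqP nk) eqxx.
- case nj: (n %| j)%N => //; case nk: (n %| k)%N => //.
  by rewrite dvdn_addr // nk in e2.
Qed.

Lemma eqpm_countC n j k : odd n ->
  (j == k %[mod n])%N%:R + (n %| j + k)%N%:R =
  (eqpm n j k)%:R + (n %| j)%N%:R * (n %| k)%N%:R :> algC.
Proof. by move=> oddn; rewrite -natrM -!natrD eqpm_count. Qed.

(* The order of [j] in the additive group of integers modulo [n]. *)
Definition ordmod n j := (n %/ gcdn j n)%N.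

Lemma ordmod_dvd n j : (ordmod n j %| n)%N.
Proof. by rewrite dvdn_div // dvdn_gcdr. Qed.

Lemma ordmod_eqpm n j k : eqpm n j k -> ordmod n j = ordmod n k.
Proof.
rewrite /ordmod => /orP[/eqP jk | njk]; first by rewrite -gcdn_modl jk gcdn_modl.
congr (_ %/ _)%N; apply/eqP; rewrite eqn_dvd !dvdn_gcd !dvdn_gcdr !andbT.
apply/andP; split.
  by rewrite -(dvdn_addr _ (dvdn_gcdl j n)) (dvdn_trans _ njk) // dvdn_gcdr.
by rewrite -(dvdn_addl _ (dvdn_gcdl k n)) (dvdn_trans _ njk) // dvdn_gcdr.
Qed.

Lemma ordmodM n j r : coprime r n -> ordmod n (j * r) = ordmod n j.
Proof. by move=> co; rewrite /ordmod gcdnC Gauss_gcdl 1?gcdnC // coprime_sym. Qed.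

Lemma ordmod_div n d : (0 < n)%N -> (d %| n)%N -> ordmod n (n %/ d) = d.
Proof.
move=> n_gt0 dn; have d_gt0 := dvdn_gt0 n_gt0 dn.
rewrite /ordmod (gcdn_idPl _) ?dvdn_div // -{1}(divnK dn) mulKn //.
by rewrite divn_gt0 // dvdn_leq.
Qed.

Lemma ordmod_factor n j : (0 < n)%N ->
  exists2 r, coprime r (ordmod n j) & j = (n %/ ordmod n j * r)%N.
Proof.
move=> n_gt0; have g_gt0 : (0 < gcdn j n)%N by rewrite gcdn_gt0 n_gt0 orbT.
exists (j %/ gcdn j n)%N.
  by rewrite /coprime -(eqn_pmul2r g_gt0) muln_gcdl mul1n !divnK ?dvdn_gcdl ?dvdn_gcdr.
by rewrite /ordmod divnA ?dvdn_gcdr // mulKn // mulnC divnK // dvdn_gcdl.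
Qed.

Lemma card_ordmod n d : (0 < n)%N -> (d %| n)%N ->
  #|[set j : 'I_n | ordmod n j == d]| = totient d.
Proof.
move=> n_gt0 dn; have d_gt0 := dvdn_gt0 n_gt0 dn.
have e_gt0 : (0 < n %/ d)%N by rewrite divn_gt0 // dvdn_leq.
have lt_k (k : 'I_d) : (n %/ d * k < n)%N by rewrite -{2}(divnK dn) ltn_pmul2l.
rewrite totient_count_coprime big_mkord -big_mkcond sum1_card.
have inj : injective (fun k : 'I_d => Ordinal (lt_k k)).
  by move=> k k' /(congr1 val) /= /eqP; rewrite eqn_pmul2l // => /eqP/val_inj.
rewrite -(card_imset _ inj); apply: eq_card => j; rewrite inE.
apply/eqP/imsetP=> [Dd | [k]].
  have [r co Dj] := ordmod_factor j n_gt0; rewrite Dd in co Dj.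
  have lt_r : (r < d)%N by rewrite -(ltn_pmul2l e_gt0) -Dj divnK.
  exists (Ordinal lt_r); last exact: val_inj.
  by rewrite -topredE /= -[eqn _ _]/(coprime d r) coprime_sym.
rewrite -topredE /= -[eqn _ _]/(coprime d k) coprime_sym => co ->; rewrite /ordmod /=.
have -> : gcdn (n %/ d * k) n = (n %/ d)%N.
  by rewrite -{2}(divnK dn) -muln_gcdr (eqP co) muln1.
by rewrite -{1}(divnK dn) mulKn.
Qed.

(** The solutions are the residues of [k] and of its opposite; they coincide exactly when [n]
    divides [k]. *)
Lemma sum_eqpm n k : odd n -> (\sum_(j < n) eqpm n j k + (n %| k) = 2)%N.
Proof.
move=> oddn; have n_gt0 : (0 < n)%N by case: n oddn.
have sum_mod m : (\sum_(j < n) (j == m %[mod n]) = 1)%N.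
  rewrite (bigD1 (Ordinal (ltn_pmod m n_gt0))) //= modn_mod eqxx big1 ?addn0 //.
  move=> j; rewrite -val_eqE /= => /negPf; rewrite (modn_small (ltn_ord j)) => ->//.
have : (\sum_(j < n) ((j == k %[mod n]) + (n %| j + k)) = 2)%N.
  rewrite big_split /= sum_mod -[2%N]/(1 + 1)%N; congr (_ + _)%N.
  rewrite -(sum_mod (n - k %% n)%N); apply: eq_bigr => j _; congr nat_of_bool.
  have k0 : ((n - k %% n + k) %% n = 0)%N.
    by rewrite addnC -modnDml subnKC ?modnn // ltnW // ltn_pmod.
  by rewrite -(eqn_modDr k) k0.
under eq_bigr do rewrite eqpm_count //.
rewrite big_split /= => <-; congr (_ + _)%N.
rewrite -big_distrl /= (bigD1 (Ordinal n_gt0)) //= dvdn0 big1 ?addn0 ?mul1n //.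
by move=> j; rewrite -val_eqE /= -lt0n => j_gt0; rewrite gtnNdvd.
Qed.

(** * Families of characters indexed by a torus *)

(* [Z j] is attached to the [j]-th power of a faithful linear character of a torus
   of order [n], and [eqpm n j k] means that [j] and [k] are equal up to sign
   modulo [n].  [fam_real] says that the Schur index over the rationals is 1. *)
Record torus_family (gT : finGroupType) (G : {group gT}) n (Z : nat -> 'CF(G)) : Prop := {
  fam_odd : odd n;
  fam_irr : forall j, Z j \in irr G;
  fam_dot : forall j k, '[Z j, Z k] = (eqpm n j k)%:R;
  fam_aut : forall u : {rmorphism algC -> algC},
    exists2 r, coprime r n & forall j, cfAut u (Z j) = Z (j * r)%N;
  fam_conj : forall d r, (d %| n)%N -> coprime r d ->
    exists u : {rmorphism algC -> algC}, Z (n %/ d * r)%N = cfAut u (Z (n %/ d)%N);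
  fam_real : forall j, exists M : QGmodule G, '[qchar M, Z j] = 1
}.

Section Family.
Variables (gT : finGroupType) (G : {group gT}) (n : nat) (Z : nat -> 'CF(G)).
Hypothesis famZ : torus_family n Z.
Let n_gt0 : (0 < n)%N. Proof. by case: n (fam_odd famZ). Qed.

Definition fam_Iirr j := cfIirr (Z j).
Definition fam_block d := [set fam_Iirr (val j) | j in [set j : 'I_n | ordmod n j == d]].

Lemma fam_IirrE j : 'chi_(fam_Iirr j) = Z j.
Proof. exact/cfIirrE/(fam_irr famZ). Qed.

Lemma eq_fam_Iirr j k : (fam_Iirr j == fam_Iirr k) = eqpm n j k.
Proof.
have := fam_dot famZ j k; rewrite -!fam_IirrE cfdot_irr.
by move/eqP; rewrite eqr_nat; case: (fam_Iirr j == _); case: (eqpm n j k).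
Qed.

Lemma fam_Iirr_mod j : fam_Iirr (j %% n) = fam_Iirr j.
Proof. by apply/eqP; rewrite eq_fam_Iirr /eqpm modn_mod eqxx. Qed.

Lemma mem_fam_block d j : (fam_Iirr j \in fam_block d) = (ordmod n j == d).
Proof.
apply/imsetP/idP=> [[k] | ord_j].
  by rewrite inE => /eqP <- /eqP; rewrite eq_fam_Iirr => /ordmod_eqpm->.
exists (Ordinal (ltn_pmod j n_gt0)); last by rewrite /= fam_Iirr_mod.
by rewrite inE /= /ordmod gcdn_modl.
Qed.

(** Exponents of order [d] have the form [n / d * r] with [r] coprime to [d]: [fam_conj] makes the
    Galois action transitive on them, and [fam_aut] keeps it inside the block. *)
Lemma fam_qmodule d : (d %| n)%N ->
  exists2 M : QGmodule G, qsimple M & qchar M = \sum_(i in fam_block d) 'chi_i.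
Proof.
move=> dn; have [M Md] := fam_real famZ (n %/ d); rewrite -fam_IirrE in Md.
apply: (qsimple_orbit _ _ _ Md).
- by rewrite mem_fam_block ordmod_div.
- move=> u i /imsetP[j]; rewrite inE => ord_j ->.
  have [r co_r Zr] := fam_aut famZ u.
  suff -> : aut_Iirr u (fam_Iirr j) = fam_Iirr (j * r) by rewrite mem_fam_block ordmodM.
  by apply: irr_inj; rewrite aut_IirrE !fam_IirrE.
move=> i /imsetP[j]; rewrite inE => /eqP ord_j ->.
have [r co_r Dj] := ordmod_factor j n_gt0; rewrite ord_j in co_r Dj.
have [u Zu] := fam_conj famZ dn co_r; exists u; apply: irr_inj.
by rewrite aut_IirrE !fam_IirrE -Zu -Dj.
Qed.

(* Every block element is hit by the two residues [j] and [- j], except that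
   [0] is its own opposite. *)
Lemma sum_fam (R : nzSemiRingType) (f : Iirr G -> R) :
  \sum_(j < n) f (fam_Iirr j) + f (fam_Iirr 0%N)
    = 2%:R * \sum_(i in [set fam_Iirr (val j) | j : 'I_n]) f i.
Proof.
rewrite (partition_big_imset (fun j : 'I_n => fam_Iirr (val j))) /=.
set S := [set _ | _ in _]; have S0 : fam_Iirr 0%N \in S by apply/imsetP; exists (Ordinal n_gt0).
rewrite [f (fam_Iirr 0%N)](_ : _ = \sum_(i in S) (i == fam_Iirr 0%N)%:R * f i).
  rewrite mulr_sumr -big_split /=; apply: eq_bigr => _ /imsetP[k _ ->].
  rewrite big_mkcond /= (eq_bigr (fun j : 'I_n => (eqpm n j k)%:R * f (fam_Iirr k))).
    rewrite -mulr_suml -mulrDl -natr_sum -natrD -(sum_eqpm k (fam_odd famZ)).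
    congr ((_ + _)%:R * _).
    by rewrite eq_fam_Iirr /eqpm addn0 mod0n -[(k %% n == 0)%N]/(n %| k)%N orbb.
  by move=> j _; rewrite -eq_fam_Iirr; case: eqP => [->|]; rewrite ?mul1r ?mul0r.
rewrite (bigD1 (fam_Iirr 0%N)) //= eqxx mul1r big1 ?addr0 // => i /andP[_ /negPf->].
by rewrite mul0r.
Qed.

(** The residues of order [d] pair off under sign; as [n] is odd, only the residue 0, of order 1, is
    its own opposite. *)
Lemma card_fam_block d : (d %| n)%N -> (2 * #|fam_block d| = totient d + (d == 1))%N.
Proof.
move=> dn; have := @sum_fam int (fun i => (i \in fam_block d)%:R).
under eq_bigr do rewrite mem_fam_block.
rewrite mem_fam_block [ordmod n 0%N]/ordmod gcd0n divnn n_gt0 -[nat_of_bool true]/1%N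
  [(1%N == d)%N]eq_sym.
rewrite -!natr_sum -natrD -natrM => /eqP; rewrite eqr_nat => /eqP E.
rewrite -(card_ordmod n_gt0 dn).
have -> : #|[set j : 'I_n | ordmod n j == d]| = (\sum_(j < n) (ordmod n j == d))%N.
  by rewrite -sum1_card big_mkcond; apply: eq_bigr => j _; rewrite inE; case: eqP.
rewrite E; congr (_ * _)%N; rewrite -sum1_card big_mkcond [RHS]big_mkcond /=.
apply: eq_bigr => i _; case: ifP => [/imsetP[j _ ->] | notb].
  by rewrite imset_f.
by case: ifP.
Qed.

Lemma fam_block_one : fam_block 1 = [set fam_Iirr 0%N].
Proof.
have /eqP := card_fam_block (dvd1n n).
rewrite -[X in _ == X]/(2 * 1)%N eqn_pmul2l // => /cards1P[x Dx].
have : fam_Iirr 0%N \in fam_block 1 by rewrite mem_fam_block /ordmod gcd0n divnn n_gt0.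
by rewrite Dx inE => /eqP->.
Qed.

Lemma cfdot_fam_block d j :
  '[\sum_(i in fam_block d) 'chi_i, Z j] = (ordmod n j == d)%:R.
Proof.
rewrite -mem_fam_block -fam_IirrE cfdot_suml.
under eq_bigr do rewrite cfdot_irr.
rewrite -natr_sum; congr _%:R.
have [b | nb] := boolP (_ \in fam_block d).
  by rewrite (bigD1 (fam_Iirr j)) //= eqxx big1 // => i /andP[_ /negPf->].
by rewrite big1 // => i bi; case: eqP => // Di; rewrite -Di bi in nb.
Qed.

Lemma fam_block1 d c : (forall j, ordmod n j = d -> Z j 1%g = c) ->
  (\sum_(i in fam_block d) 'chi_i) 1%g = #|fam_block d|%:R * c.
Proof.
move=> Zc; rewrite sum_cfunE -sum1_card natr_sum mulr_suml.
apply: eq_bigr => i /imsetP[j]; rewrite inE => /eqP ord_j ->.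
by rewrite fam_IirrE Zc // mul1r.
Qed.

Lemma fam_qmodules : exists V : nat -> QGmodule G, forall d, (d %| n)%N ->
  qsimple (V d) /\ qchar (V d) = \sum_(i in fam_block d) 'chi_i.
Proof.
(* The choice is made over a finite type; an index that does not divide [n] gets an arbitrary
   module. *)
have ex_V (d : 'I_n.+1) : exists M : QGmodule G, (d %| n)%N ->
    qsimple M /\ qchar M = \sum_(i in fam_block d) 'chi_i.
  have [/fam_qmodule[M simM DM] | _] := boolP (d %| n)%N; first by exists M.
  by have [M _] := fam_real famZ 0%N; exists M.
have [V DV] := fin_all_exists ex_V.
exists (fun d => V (inord d)) => d dn.
have Dd : (inord d : 'I_n.+1) = d :> nat by apply: inordK; rewrite ltnS dvdn_leq.
by have := DV (inord d); rewrite Dd => /(_ dn).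
Qed.

End Family.

(** * Induction from self-centralizing subgroups *)

Section CfunPointwise.
Variables (gT : finGroupType) (G : {group gT}).

Lemma cfunDE (phi psi : 'CF(G)) x : (phi + psi) x = phi x + psi x.
Proof. by rewrite cfunE. Qed.

Lemma cfunNE (phi : 'CF(G)) x : (- phi) x = - phi x.
Proof. by rewrite cfunE. Qed.

Lemma cfunZE a (phi : 'CF(G)) x : (a *: phi) x = a * phi x.
Proof. by rewrite cfunE. Qed.

End CfunPointwise.

Section Induction.
Variables (gT : finGroupType) (G : {group gT}).
Implicit Types H K : {group gT}.

Lemma sum_conjg (R : nzRingType) (x : gT) (f : gT -> R) : x \in G ->
  \sum_(y in G) f (x ^ y)%g = #|'C_G[x]|%:R * \sum_(z in x ^: G) f z.
Proof.
move=> Gx; rewrite (partition_big (conjg x) (mem (x ^: G))) /=; last first.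
  by move=> y Gy; apply: imset_f.
rewrite mulr_sumr; apply: eq_bigr => _ /imsetP[a Ga ->].
rewrite (eq_bigr (fun=> f (x ^ a)%g)); last by move=> y /andP[_ /eqP->].
rewrite sumr_const -[in RHS](card_rcoset _ a) -(mulr_natl (f _)); congr (_ * _).
congr _%:R; apply: eq_card => y.
rewrite mem_rcoset in_setI groupMr ?groupV // -topredE /=; case: (y \in G) => //=.
rewrite cent1E mulgA (conjgC x y) [(_ * x)%g](_ : _ = y * x ^ a * a^-1)%g.
  by rewrite (can_eq (mulgK _)) (can_eq (mulKg _)) eq_sym.
by rewrite conjgE !mulgA mulgK.
Qed.

Lemma cfInd_self_cent H (phi : 'CF(H)) x : H \subset G -> x \in G -> #|'C_G[x]| = #|H| ->
  'Ind[G] phi x = \sum_(z in x ^: G) phi z.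
Proof.
by move=> sHG Gx Cx; rewrite cfIndE // sum_conjg // Cx mulKf // neq0CG.
Qed.

Lemma cfInd_nconj H (phi : 'CF(H)) x : H \subset G -> [disjoint x ^: G & H] ->
  'Ind[G] phi x = 0.
Proof.
move=> sHG /pred0P dis; rewrite cfIndE // big1 ?mulr0 // => y Gy.
by rewrite cfun0 //; have /= := dis (x ^ y)%g; rewrite imset_f //= => ->.
Qed.

Lemma cfdot_cfReg (phi : 'CF(G)) : '[phi, cfReg G] = phi 1%g.
Proof.
rewrite cfdotE (big_setD1 1%g) ?group1 //= cfRegE eqxx mulr1n conjC_nat.
rewrite big1 ?addr0 => [|x /setD1P[/negPf nx _]]; last by rewrite cfRegE nx mulr0n conjC0 mulr0.
by rewrite mulrC mulfK ?neq0CG.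
Qed.

Lemma cfRes_Ind_disjoint H K (phi : 'CF(H)) : H \subset G -> K \subset G ->
  (forall x, x \in K^# -> [disjoint x ^: G & H]) ->
  'Res[K] ('Ind[G] phi) = (#|G : H|%:R * phi 1%g / #|K|%:R) *: cfReg K.
Proof.
move=> sHG sKG dis; apply/cfun_inP=> x Kx; rewrite cfResE // cfunE cfRegE.
have [-> | ntx] := eqVneq x 1%g; first by rewrite cfInd1 // mulfVK ?neq0CG.
by rewrite mulr0n mulr0 cfInd_nconj // dis // !inE ntx.
Qed.

End Induction.

(** A character is determined by its value at a generator, a root of unity of order dividing |H|.
    There are as many characters as such roots, so a primitive root occurs as a value. *)
Lemma cyclic_lin_char (gT : finGroupType) (H : {group gT}) : cyclic H ->
  exists2 lambda : 'CF(H), lambda \is a linear_char &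
    forall j, (lambda ^+ j == 1) = (#|H| %| j)%N.
Proof.
move=> cycH; have [h defH] := cyclicP cycH; set n := #|H|.
have Hh : h \in H by rewrite defH cycle_id.
have ordh : #[h] = n by rewrite /n defH.
have n_gt0 : (0 < n)%N := cardG_gt0 H.
have [w prim_w] := C_prim_root_exists n_gt0.
have lin_i (i : Iirr H) : 'chi_i \is a linear_char by apply: irr_cyclic_lin.
have ex_k i : exists k : 'I_n, 'chi[H]_i h == w ^+ k.
  have: 'chi[H]_i h ^+ n = 1 by rewrite -ordh lin_char_unity_root.
  by case/(prim_rootP prim_w)=> k ->; exists k.
pose f i := xchoose (ex_k i).
have Df i : 'chi[H]_i h = w ^+ f i by apply/eqP/(xchooseP (ex_k i)).
have injf : injective f.
  move=> i j eq_f; apply: irr_inj; apply/cfun_inP=> x Hx.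
  have /cycleP[m ->] : x \in <[h]> by rewrite -defH.
  by rewrite !lin_charX // !Df eq_f.
have [g _ gK] : bijective f.
  by apply: inj_card_bij => //; rewrite card_Iirr_cyclic // card_ord.
pose i1 := g (Ordinal (ltn_pmod 1 n_gt0)).
have Dw : 'chi_i1 h = w by rewrite Df gK /= (prim_expr_mod prim_w) expr1.
exists 'chi_i1 => // j; rewrite (prim_order_dvd prim_w) -Dw.
apply/eqP/eqP=> [lam1 | w1].
  by rewrite -exp_cfunE // lam1 cfun1E Hh.
apply/cfun_inP=> x Hx; rewrite exp_cfunE // cfun1E Hx.
have /cycleP[m ->] : x \in <[h]> by rewrite -defH.
by rewrite lin_charX // exprAC w1 expr1n.
Qed.

Lemma lin_char_exp (gT : finGroupType) (H : {group gT}) (xi : 'CF(H)) j :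
  xi \is a linear_char -> xi ^+ j \is a linear_char.
Proof. exact: rpredX. Qed.

Lemma cfAut_lin_char_exp (gT : finGroupType) (H : {group gT}) (xi : 'CF(H)) d r
    (u : {rmorphism algC -> algC}) :
    xi \is a linear_char -> xi ^+ d = 1 -> (forall z, z ^+ d = 1 -> u z = z ^+ r) ->
  cfAut u xi = xi ^+ r.
Proof.
move=> Lxi xid uE; apply/cfun_inP=> x Hx; rewrite cfunE exp_cfunE // uE //.
by rewrite -exp_cfunE // xid cfun1E Hx.
Qed.

Lemma cfAut_faithful_lin_char (gT : finGroupType) (H : {group gT}) (lam : 'CF(H)) :
    lam \is a linear_char -> (forall j, (lam ^+ j == 1) = (#|H| %| j)%N) ->
  forall u : {rmorphism algC -> algC},
  exists2 r, coprime r #|H| & forall j, cfAut u (lam ^+ j) = lam ^+ (j * r).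
Proof.
move=> Llam lam1 u; have [w prim_w] := C_prim_root_exists (cardG_gt0 H).
have [r co_r uw] := aut_prim_rootP u prim_w.
exists r => // j; rewrite rmorphXn /= (cfAut_lin_char_exp (d := #|H|) (r := r)) //.
- by rewrite -exprM mulnC.
- by apply/eqP; rewrite lam1.
by move=> z /(prim_rootP prim_w)[i ->]; rewrite rmorphXn /= uw exprAC.
Qed.

Lemma Galois_conj_lin_char (gT : finGroupType) (H : {group gT}) (lam : 'CF(H)) d r :
    lam \is a linear_char -> (forall j, (lam ^+ j == 1) = (#|H| %| j)%N) ->
    (d %| #|H|)%N -> coprime r d ->
  exists u : {rmorphism algC -> algC},
    cfAut u (lam ^+ (#|H| %/ d)) = lam ^+ (#|H| %/ d * r).
Proof.
move=> Llam lam1 dH co_r; have [u uE] := Qn_aut_exists co_r.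
exists u; rewrite (cfAut_lin_char_exp (d := d) (r := r)) ?exprM //.
  exact: lin_char_exp.
by rewrite -exprM divnK //; apply/eqP; rewrite lam1.
Qed.

Record inverting_torus (gT : finGroupType) (G H : {group gT}) : Prop := {
  torus_sub : H \subset G;
  torus_cyclic : cyclic H;
  torus_odd : odd #|H|;
  torus_cent1 : {in H^#, forall x, 'C_G[x] = H};
  torus_conj : {in H & G, forall x y, (x ^ y)%g \in H ->
    (x ^ y)%g = x \/ (x ^ y)%g = x^-1%g};
  torus_inv : {in H, forall x, exists2 y, y \in G & (x ^ y)%g = x^-1%g}
}.

Section Torus.
Variables (gT : finGroupType) (G H : {group gT}).
Hypothesis torH : inverting_torus G H.
Let sHG : H \subset G. Proof. by case: torH. Qed.
(** Off the identity the induced character agrees on [H] with the sum of [xi] and its conjugate, of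
    degree 2; the remaining degree |G : H| - 2 is filled by [c] times the regular character. *)
Let c : algC := (#|G : H|%:R - 2) / #|H|%:R.

Lemma torus_Res_Ind (xi : 'CF(H)) : xi \is a linear_char ->
  'Res[H] ('Ind[G] xi) = xi + (xi^*)%CF + c *: cfReg H.
Proof.
move=> Lxi; have [_ _ oddH cH conjH invH] := torH.
apply/cfun_inP=> x Hx; rewrite cfResE // !cfunDE cfunZE cfConjCE cfRegE.
have [-> | ntx] := eqVneq x 1%g.
  rewrite cfInd1 // lin_char1 // conjC1 mulfVK ?neq0CG // mulr1.
  by rewrite addrC subrK.
rewrite mulr0n mulr0 addr0 (cfInd_self_cent _ sHG) ?(subsetP sHG) //; last first.
  by rewrite cH // !inE ntx.
have xV : x != x^-1%g.
  apply: contraNneq ntx => xV; rewrite -order_eq1 -dvdn1.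
  have /eqP <-: coprime #|H| 2 by rewrite coprime_sym coprime2n.
  by rewrite dvdn_gcd order_dvdG // order_dvdn expgS expg1 {2}xV mulgV /=.
have [y Gy Dy] := invH x Hx.
rewrite (big_setID H) /= addrC big1 ?add0r => [|z]; last first.
  by rewrite inE => /andP[notHz _]; rewrite cfun0.
rewrite (_ : x ^: G :&: H = [set x; x^-1%g]).
  by rewrite big_setU1 ?inE // big_set1 lin_charV_conj.
apply/setP=> z; rewrite !inE; apply/idP/idP.
  case/andP=> /imsetP[t Gt ->] Hxt; have [-> | ->] := conjH x t Hx Gt Hxt.
    by rewrite eqxx.
  by rewrite eqxx orbT.
case/orP=> /eqP->; first by rewrite class_refl.
by rewrite groupV Hx andbT -Dy memJ_class.
Qed.

Variable lambda : 'CF(H).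
Hypotheses (Llambda : lambda \is a linear_char)
  (lambda1 : forall j, (lambda ^+ j == 1) = (#|H| %| j)%N).

Lemma eq_lambda_exp j k : (lambda ^+ j == lambda ^+ k) = (j == k %[mod #|H|])%N.
Proof.
wlog le_jk : j k / (j <= k)%N.
  move=> IH; have [/IH // | /ltnW/IH E] := leqP j k.
  by rewrite eq_sym E eq_sym.
rewrite eq_sym [RHS]eq_sym eqn_mod_dvd // -lambda1 -{1}(subnK le_jk) exprD.
rewrite -[X in _ == X]mul1r (inj_eq (mulIr _)) //.
exact: lin_char_unitr (lin_char_exp _ _).
Qed.

Lemma cfdot_Ind_torus j k :
  '['Ind[G] (lambda ^+ j), 'Ind[G] (lambda ^+ k)]
    = (j == k %[mod #|H|])%N%:R + (#|H| %| j + k)%N%:R + c.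
Proof.
have Lj m : lambda ^+ m \is a linear_char by apply: lin_char_exp.
have irrj m : lambda ^+ m \in irr H by apply: lin_char_irr.
rewrite -cfdot_Res_r torus_Res_Ind // !cfdotDr cfdotZr cfdot_cfReg lin_char1 // mulr1.
rewrite (_ : c^* = c); last by rewrite fmorph_div rmorphB /= !rmorph_nat.
have dot_irr (i1 i2 : 'CF(H)) : i1 \in irr H -> i2 \in irr H -> '[i1, i2] = (i1 == i2)%:R.
  by case/irrP=> i ->; case/irrP=> i' ->; rewrite cfdot_irr (inj_eq irr_inj).
rewrite !dot_irr ?cfConjC_irr // ?eq_lambda_exp; last first.
  by case/irrP: (irrj k) => i ->; apply: cfConjC_irr.
congr (_ + _%:R + _); congr nat_of_bool.
rewrite -lambda1 exprD -invr_lin_char //.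
rewrite -(inj_eq (mulIr (lin_char_unitr (Lj k)))) mulVr //.
exact: lin_char_unitr.
Qed.

Lemma cfdot_Ind_torus_cfun1 j :
  '['Ind[G] (lambda ^+ j), 1] = (#|H| %| j)%N%:R.
Proof.
rewrite -cfdot_Res_r cfRes_cfun1 -lambda1.
have /irrP[i ->] : lambda ^+ j \in irr H by apply: lin_char_irr (lin_char_exp _ _).
by rewrite -irr0 cfdot_irr (inj_eq irr_inj).
Qed.

End Torus.

(** * The irreducible characters *)

(** All that the character computation uses about the group. These facts are invariant under
    isomorphism, so they are checked on matrices and carried to the quotient by the center, which
    they show to be trivial. *)
Record sl2_like q (gT : finGroupType) (G U T C : {group gT}) : Prop := {
  sl2_q : (1 < q)%N;
  sl2_cardG : #|G| = (q * (q ^ 2 - 1))%N;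
  sl2_cardU : #|U| = q;
  sl2_cardT : #|T| = (q - 1)%N;
  sl2_cardC : #|C| = (q + 1)%N;
  sl2_U : U \subset G;
  sl2_expU : {in U, forall x, x ^+ 2 = 1}%g;
  sl2_centU : {in U^#, forall x, 'C_G[x] = U};
  sl2_conjU : {in U^# &, forall x y, y \in x ^: G};
  sl2_T : inverting_torus G T;
  sl2_C : inverting_torus G C
}.

(** Conjugate elements have centralizers of equal order, which would here be both [#|H|] and
    [#|K|]. *)
Lemma disjoint_class_cent1 (gT : finGroupType) (G H K : {group gT}) x :
  H \subset G -> {in H^#, forall x, 'C_G[x] = H} -> {in K^#, forall x, 'C_G[x] = K} ->
  #|H| != #|K| -> x \in H^# -> [disjoint x ^: G & K].
Proof.
move=> sHG cH cK neqHK Hx; rewrite disjoint_subset; apply/subsetP=> _ /imsetP[y Gy ->].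
rewrite inE /=; apply: contra neqHK => Kxy; have [ntx _] := setD1P Hx.
have Kxy1 : (x ^ y)%g \in K^# by rewrite !inE conjg_eq1 ntx.
by rewrite -(cH x Hx) -(cK _ Kxy1) -{2}(conjGid Gy) -conjg_set1 normJ -conjIg cardJg.
Qed.

Section Characters.
Variables (q : nat) (gT : finGroupType) (G U T C : {group gT}).
Hypothesis slG : sl2_like q G U T C.
Let Q : algC := q%:R.

Let q_gt1 := sl2_q slG.
Let sUG := sl2_U slG.
Let sTG := torus_sub (sl2_T slG).
Let sCG := torus_sub (sl2_C slG).

Lemma sl2_indexes : [/\ #|G : U|%:R = Q ^+ 2 - 1 :> algC,
   #|G : T|%:R = Q * (Q + 1) :> algC & #|G : C|%:R = Q * (Q - 1) :> algC].
Proof.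
have cU := sl2_cardU slG; have cT := sl2_cardT slG; have cC := sl2_cardC slG.
have cG := sl2_cardG slG.
have nzU : Q != 0 by rewrite -[Q]/(q%:R) -cU neq0CG.
have nzT : Q - 1 != 0 by rewrite -(natrB _ (ltnW q_gt1)) -cT neq0CG.
have nzC : Q + 1 != 0 by rewrite -(natrD _ q 1) -cC neq0CG.
have GE : #|G|%:R = Q * (Q ^+ 2 - 1) :> algC.
  by rewrite cG natrM natrB ?expn_gt0 ?(ltnW q_gt1) // natrX.
rewrite !natf_indexg // GE cU cT cC natrD natrB ?(ltnW q_gt1) // -/Q.
split; field; done.
Qed.

Lemma sl2_mu : exists mu : 'CF(U),
  [/\ mu \is a linear_char, mu != 1 & forall x, mu x \in Crat].
Proof.
have abU : abelian U.
  apply/subsetP=> x Ux; have [-> | ntx] := eqVneq x 1%g; first exact: group1.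
  have Ux1 : x \in U^# by rewrite !inE ntx.
  rewrite -sub_cent1 -{1}(sl2_centU slG Ux1); exact: subsetIr.
have cardI : #|Iirr U| = q by rewrite card_Iirr_abelian // (sl2_cardU slG).
have [i nzi] : exists i : Iirr U, i != 0.
  apply/existsP; apply: contraTT q_gt1 => /existsPn all0.
  rewrite -leqNgt -cardI -(card1 (0 : Iirr U)); apply/subset_leq_card/subsetP=> i _.
  by rewrite inE; apply/negPn/all0.
have Li : 'chi_i \is a linear_char by apply/char_abelianP.
exists 'chi_i; split=> // [|x]; first by rewrite -irr0 (inj_eq irr_inj).
have [Ux | /cfun0->] := boolP (x \in U); last exact: rpred0.
have /eqP := lin_charX Li 2 Ux; rewrite (sl2_expU slG Ux) lin_char1 // eq_sym sqrf_eq1.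
by case/orP=> /eqP->; rewrite ?rpredN rpred1.
Qed.

Variable mu : 'CF(U).
Hypotheses (Lmu : mu \is a linear_char) (mu1 : mu != 1) (muQ : forall x, mu x \in Crat).
Let Gamma := 'Ind[G] mu.

Lemma cfdot_mu1 : '[mu, 1] = 0.
Proof.
have /irrP[i Di] := lin_char_irr Lmu.
by rewrite Di -irr0 cfdot_irr; case: eqP => // i0; case/negP: (mu1); rewrite Di i0 irr0.
Qed.

(** All nontrivial elements of [U] are conjugate, so [Gamma] takes at each of them the sum of [mu]
    over [U^#], which is -1 because [mu] is orthogonal to 1. *)
Lemma Gamma_Res_U : 'Res[U] Gamma = Q *: cfReg U - 1.
Proof.
have [iU _ _] := sl2_indexes.
apply/cfun_inP=> x Ux; rewrite cfResE // cfunDE cfunNE cfunZE cfun1E Ux cfRegE.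
have [-> | ntx] := eqVneq x 1%g.
  by rewrite cfInd1 // lin_char1 // iU (sl2_cardU slG) mulr1.
have Ux1 : x \in U^# by rewrite !inE ntx.
rewrite mulr0n mulr0 (cfInd_self_cent _ sUG) ?(subsetP sUG) ?(sl2_centU slG) //.
have := cfdot_mu1; rewrite cfdotE => /eqP; rewrite mulf_eq0 invr_eq0 (negPf (neq0CG U)) /=.
rewrite (big_setD1 1%g) //= lin_char1 // cfun11 conjC1 mulr1.
rewrite addrC addr_eq0 => /eqP E; rewrite sub0r -E.
rewrite (big_setID U^#) /= [X in _ + X]big1 ?addr0; last first.
  move=> _ /setDP[/imsetP[y Gy ->]]; rewrite !inE conjg_eq1 ntx /=.
  exact: cfun0.
apply: eq_big => [y | y]; last first.
  by rewrite inE cfun1E => /andP[_ /setD1P[_ ->]]; rewrite conjC1 mulr1.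
rewrite inE; case U1y: (y \in U^#); rewrite ?andbF // andbT.
exact: (sl2_conjU slG).
Qed.

Lemma cfnorm_Gamma : '[Gamma] = Q.
Proof.
rewrite -cfdot_Res_r Gamma_Res_U cfdotBr cfdotZr cfdot_cfReg lin_char1 // conjC_nat mulr1.
by rewrite cfdot_mu1 subr0.
Qed.

Lemma cfdot_Gamma1 : '[Gamma, 1] = 0.
Proof.
by rewrite -cfdot_Res_r cfRes_cfun1 cfdot_mu1.
Qed.

Lemma cfdot_Ind_disjoint (H K : {group gT}) (phi : 'CF(H)) (psi : 'CF(K)) :
    H \subset G -> K \subset G ->
    {in H^#, forall x, 'C_G[x] = H} -> {in K^#, forall x, 'C_G[x] = K} ->
    #|H| != #|K| -> phi \is a linear_char -> psi \is a linear_char ->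
  '['Ind[G] phi, 'Ind[G] psi] = #|G : H|%:R / #|K|%:R.
Proof.
move=> sHG sKG cH cK neqHK Lphi Lpsi.
rewrite -cfdot_Res_l cfRes_Ind_disjoint // => [|x Kx]; last first.
  by apply: (disjoint_class_cent1 sKG) => //; rewrite eq_sym.
rewrite cfdotZl cfdotC cfdot_cfReg !lin_char1 // conjC1 !mulr1 //.
Qed.

Let nzT : Q - 1 != 0.
Proof. by rewrite -(natrB _ (ltnW q_gt1)) -(sl2_cardT slG) neq0CG. Qed.
Let nzC : Q + 1 != 0.
Proof. by rewrite -(natrD _ q 1) -(sl2_cardC slG) neq0CG. Qed.
Let cardT : #|T|%:R = Q - 1 :> algC.
Proof. by rewrite (sl2_cardT slG) natrB ?(ltnW q_gt1). Qed.
Let cardC : #|C|%:R = Q + 1 :> algC.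
Proof. by rewrite (sl2_cardC slG) natrD. Qed.

Variables (lamT : 'CF(T)) (lamC : 'CF(C)).
Hypotheses (LlamT : lamT \is a linear_char) (LlamC : lamC \is a linear_char).
Hypotheses (lamT1 : forall j, (lamT ^+ j == 1) = (#|T| %| j)%N)
  (lamC1 : forall j, (lamC ^+ j == 1) = (#|C| %| j)%N).

Lemma cfdot_Gamma_IndT j : '[Gamma, 'Ind[G] (lamT ^+ j)] = Q + 1.
Proof.
have [iU _ _] := sl2_indexes.
rewrite cfdot_Ind_disjoint ?lin_char_exp ?iU ?cardT //.
- by field.
- exact: sl2_centU slG.
- exact: torus_cent1 (sl2_T slG).
- by rewrite (sl2_cardU slG) (sl2_cardT slG) eq_sym ltn_eqF // ltn_subrL (ltnW q_gt1).
Qed.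

Lemma cfdot_Gamma_IndC j : '[Gamma, 'Ind[G] (lamC ^+ j)] = Q - 1.
Proof.
have [iU _ _] := sl2_indexes.
rewrite cfdot_Ind_disjoint ?lin_char_exp ?iU ?cardC //.
- by field.
- exact: sl2_centU slG.
- exact: torus_cent1 (sl2_C slG).
- by rewrite (sl2_cardU slG) (sl2_cardC slG) addn1 ltn_eqF.
Qed.

Lemma cfdot_IndT_IndC j k : '['Ind[G] (lamT ^+ j), 'Ind[G] (lamC ^+ k)] = Q.
Proof.
have [_ iT _] := sl2_indexes.
rewrite cfdot_Ind_disjoint ?lin_char_exp ?iT ?cardC //.
- by field.
- exact: torus_cent1 (sl2_T slG).
- exact: torus_cent1 (sl2_C slG).
- by rewrite (sl2_cardT slG) (sl2_cardC slG) ltn_eqF // addn1 ltnS leq_subr.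
Qed.

Lemma cfdot_IndT_IndT j k : '['Ind[G] (lamT ^+ j), 'Ind[G] (lamT ^+ k)] =
  (j == k %[mod #|T|])%N%:R + (#|T| %| j + k)%N%:R + (Q + 2).
Proof.
have [_ iT _] := sl2_indexes.
rewrite (cfdot_Ind_torus (sl2_T slG)) // iT cardT; congr (_ + _).
by field.
Qed.

Lemma cfdot_IndC_IndC j k : '['Ind[G] (lamC ^+ j), 'Ind[G] (lamC ^+ k)] =
  (j == k %[mod #|C|])%N%:R + (#|C| %| j + k)%N%:R + (Q - 2).
Proof.
have [_ _ iC] := sl2_indexes.
rewrite (cfdot_Ind_torus (sl2_C slG)) // iC cardC; congr (_ + _).
by field.
Qed.

(* At the multiples of the order of the torus, [cuspidal] is the Steinberg
   character and [principal] the trivial one. *)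
Definition cuspidal j := Gamma - 'Ind[G] (lamC ^+ j) + (#|C| %| j)%N%:R *: 1.
Definition principal j := if (#|T| %| j)%N then 1 else 'Ind[G] (lamT ^+ j) - Gamma.

(** If [#|C|] divides [j], then [Gamma - Ind] has norm 2 and contains 1 with multiplicity -1; adding
    1 cancels this part. Otherwise the norm is already 1. *)
Lemma cfdot_cuspidal j k : '[cuspidal j, cuspidal k] = (eqpm #|C| j k)%:R.
Proof.
rewrite /cuspidal !(cfdotDl, cfdotDr, cfdotNl, cfdotNr, cfdotZl, cfdotZr).
rewrite cfnorm_Gamma cfdot_Gamma_IndC cfdot_Gamma1 cfdot_IndC_IndC.
rewrite (cfdotC ('Ind _) Gamma) cfdot_Gamma_IndC (cfdotC 1 Gamma) cfdot_Gamma1.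
rewrite (cfdotC 1 ('Ind _)) !(cfdot_Ind_torus_cfun1 G LlamC lamC1) cfnorm1.
rewrite /Q !rmorphB !rmorph0 !rmorph1 !rmorph_nat -/Q.
have := eqpm_countC j k (torus_odd (sl2_C slG)).
set e1 := (_ == _ %[mod _])%N; set e2 := (_ %| j + k)%N => E.
transitivity (e1%:R + e2%:R - (#|C| %| j)%N%:R * (#|C| %| k)%N%:R : algC); first by ring.
by rewrite E addrK.
Qed.

(** If [#|T|] divides [j], then [Ind - Gamma] has norm 2: it is 1 plus the Steinberg character. Only
    the first of these is kept, as [cuspidal] supplies the other. *)
Lemma cfdot_principal j k : '[principal j, principal k] = (eqpm #|T| j k)%:R.
Proof.
have := eqpm_countC j k (torus_odd (sl2_T slG)).
rewrite /principal; case: ifP => Tj; case: ifP => Tk E.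
- by rewrite cfnorm1 /eqpm (dvdn_modn0 Tj) (dvdn_modn0 Tk) eqxx.
- rewrite cfdotBr cfdotC (cfdot_Ind_torus_cfun1 G LlamT lamT1) Tk.
  rewrite (cfdotC 1 Gamma) cfdot_Gamma1 /eqpm dvdn_addr // Tk orbF.
  by rewrite -(modn_mod k) (dvdn_modn0 Tj) eq_sym modn_mod -[(_ %% _ == 0)%N]/(_ %| _)%N Tk
    !rmorph0 subr0.
- rewrite cfdotBl (cfdot_Ind_torus_cfun1 G LlamT lamT1) Tj cfdot_Gamma1.
  by rewrite /eqpm dvdn_addl // Tj orbF (dvdn_modn0 Tk) -[(_ %% _ == 0)%N]/(_ %| _)%N Tj subr0.
rewrite cfdotBl !cfdotBr cfnorm_Gamma cfdot_Gamma_IndT cfdot_IndT_IndT.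
rewrite (cfdotC ('Ind _) Gamma) cfdot_Gamma_IndT /Q rmorphD rmorph1 rmorph_nat -/Q.
transitivity ((j == k %[mod #|T|])%N%:R + (#|T| %| j + k)%N%:R : algC); first by ring.
by rewrite E /= mul0r addr0.
Qed.

Lemma cfdot_cuspidal_principal j k : '[cuspidal j, principal k] = 0.
Proof.
rewrite /cuspidal /principal; case: ifP => Tk.
  rewrite cfdotDl cfdotBl cfdot_Gamma1 (cfdot_Ind_torus_cfun1 G LlamC lamC1).
  by rewrite cfdotZl cfnorm1 mulr1 sub0r addNr.
rewrite cfdotDl cfdotBl cfdotZl !cfdotBr cfdot_Gamma_IndT cfnorm_Gamma.
rewrite (cfdotC ('Ind _) Gamma) cfdot_Gamma_IndC (cfdotC 1 ('Ind _)) (cfdotC 1 Gamma).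
rewrite cfdot_Gamma1 (cfdot_Ind_torus_cfun1 G LlamT lamT1) Tk.
rewrite (cfdotC ('Ind _) ('Ind _)) cfdot_IndT_IndC /Q !rmorphB !rmorph0 rmorph1 !rmorph_nat -/Q.
by ring.
Qed.

Lemma cuspidal1 j : cuspidal j 1%g = Q - 1 + (#|C| %| j)%N%:R.
Proof.
have [iU _ iC] := sl2_indexes.
rewrite cfunDE cfunDE cfunNE cfunZE cfun11 !cfInd1 // !lin_char1 ?lin_char_exp //.
by rewrite iU iC; ring.
Qed.

Lemma principal1 j : principal j 1%g = if (#|T| %| j)%N then 1 else Q + 1.
Proof.
have [iU iT _] := sl2_indexes; rewrite /principal; case: ifP => _; first exact: cfun11.
rewrite cfunDE cfunNE !cfInd1 // !lin_char1 ?lin_char_exp //.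
by rewrite iU iT; ring.
Qed.

(** A generalized character of norm 1 is irreducible up to sign, and the degree is positive. *)
Lemma cuspidal_irr j : cuspidal j \in irr G.
Proof.
have Zmu : mu \in 'Z[irr U] by apply/char_vchar/lin_charW.
have Zlam : lamC ^+ j \in 'Z[irr C] by apply/char_vchar/lin_charW/lin_char_exp.
have Zc : cuspidal j \in 'Z[irr G].
  by rewrite rpredD ?rpredB ?cfInd_vchar // scale_zchar ?cfun1_vchar ?rpred_nat.
have [|b [i Dc]] := vchar_norm1P Zc; first by rewrite cfdot_cuspidal /eqpm eqxx.
have : 0 < cuspidal j 1%g.
  rewrite cuspidal1 ltr_wpDr ?ler0n // subr_gt0 -[1](mulr1n 1) ltr_nat; exact: q_gt1.
rewrite Dc; case: b {Dc}; rewrite ?expr0 ?scale1r ?mem_irr // cfunZE expr1 mulN1r oppr_gt0.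
by move=> /(Order.POrderTheory.lt_trans (irr1_gt0 i)); rewrite Order.POrderTheory.ltxx.
Qed.

Lemma principal_irr j : principal j \in irr G.
Proof.
have Zmu : mu \in 'Z[irr U] by apply/char_vchar/lin_charW.
have Zlam : lamT ^+ j \in 'Z[irr T] by apply/char_vchar/lin_charW/lin_char_exp.
have Zc : principal j \in 'Z[irr G].
  by rewrite /principal; case: ifP => _; rewrite ?cfun1_vchar // rpredB ?cfInd_vchar.
have [|b [i Dc]] := vchar_norm1P Zc; first by rewrite cfdot_principal /eqpm eqxx.
have : 0 < principal j 1%g.
  by rewrite principal1; case: ifP; rewrite ?ltr01 // -(natrD _ q 1) ltr0n addn1.
rewrite Dc; case: b {Dc}; rewrite ?expr0 ?scale1r ?mem_irr // cfunZE expr1 mulN1r oppr_gt0.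
by move=> /(Order.POrderTheory.lt_trans (irr1_gt0 i)); rewrite Order.POrderTheory.ltxx.
Qed.

Lemma cfdot_Gamma_cuspidal j : '[Gamma, cuspidal j] = 1.
Proof.
rewrite cfdotDr cfdotBr cfdotZr cfnorm_Gamma cfdot_Gamma_IndC cfdot_Gamma1 mulr0; ring.
Qed.

Lemma cfdot_Gamma_principal j : ~~ (#|T| %| j)%N -> '[Gamma, principal j] = 1.
Proof.
move=> /negPf Tj; rewrite /principal Tj cfdotBr cfnorm_Gamma cfdot_Gamma_IndT; ring.
Qed.

Lemma cfAut_mu (u : {rmorphism algC -> algC}) : cfAut u mu = mu.
Proof.
by apply/cfunP=> x; rewrite cfunE; case/CratP: (muQ x) => a ->; rewrite fmorph_rat.
Qed.

Lemma cfAut_cuspidal (u : {rmorphism algC -> algC}) j k :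
  cfAut u (lamC ^+ j) = lamC ^+ k -> cfAut u (cuspidal j) = cuspidal k.
Proof.
move=> ujk; have dvd_kj : (#|C| %| k)%N = (#|C| %| j)%N by rewrite -!lamC1 -ujk cfAut_eq1.
rewrite /cuspidal dvd_kj rmorphD rmorphB /= cfAutZ !cfAutInd cfAut_mu ujk rmorph1.
by congr (_ + _ *: _); apply: rmorph_nat.
Qed.

Lemma cfAut_principal (u : {rmorphism algC -> algC}) j k :
  cfAut u (lamT ^+ j) = lamT ^+ k -> cfAut u (principal j) = principal k.
Proof.
move=> ujk; rewrite /principal -!lamT1 -ujk cfAut_eq1.
by case: ifP => _; rewrite ?rmorph1 // rmorphB /= !cfAutInd cfAut_mu.
Qed.

Lemma cuspidal_family : torus_family #|C| cuspidal.
Proof.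
split.
- exact: torus_odd (sl2_C slG).
- exact: cuspidal_irr.
- exact: cfdot_cuspidal.
- move=> u; have [r co_r lam_r] := cfAut_faithful_lin_char LlamC lamC1 u.
  by exists r => // j; apply: cfAut_cuspidal.
- move=> d r dn co_r; have [u lam_u] := Galois_conj_lin_char LlamC lamC1 dn co_r.
  by exists u; rewrite (cfAut_cuspidal lam_u).
- move=> j; have [M DM] := Ind_qmodule sUG Lmu muQ.
  by exists M; rewrite DM cfdot_Gamma_cuspidal.
Qed.

Lemma principal_family : torus_family #|T| principal.
Proof.
split.
- exact: torus_odd (sl2_T slG).
- exact: principal_irr.
- exact: cfdot_principal.
- move=> u; have [r co_r lam_r] := cfAut_faithful_lin_char LlamT lamT1 u.
  by exists r => // j; apply: cfAut_principal.
- move=> d r dn co_r; have [u lam_u] := Galois_conj_lin_char LlamT lamT1 dn co_r.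
  by exists u; rewrite (cfAut_principal lam_u).
- move=> j; have [Tj | Tj] := boolP (#|T| %| j)%N; last first.
    have [M DM] := Ind_qmodule sUG Lmu muQ.
    by exists M; rewrite DM cfdot_Gamma_principal.
  by exists (trivial_module G); rewrite qchar_trivial /principal Tj cfnorm1.
Qed.

Lemma cuspidal_principal_complete (i : Iirr G) :
  (exists j, 'chi_i = cuspidal j) \/ (exists j, 'chi_i = principal j).
Proof.
have fC := cuspidal_family; have fT := principal_family.
pose A := [set fam_Iirr cuspidal (val j) | j : 'I_#|C|].
pose B := [set fam_Iirr principal (val j) | j : 'I_#|T|].
have [Ai | nAi] := boolP (i \in A).
  by left; have [j _ ->] := imsetP Ai; exists j; rewrite (fam_IirrE fC).
have [Bi | nBi] := boolP (i \in B).
  by right; have [j _ ->] := imsetP Bi; exists j; rewrite (fam_IirrE fT).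
have AB : [disjoint A & B].
  apply/pred0P=> x /=; apply/negP=> /andP[/imsetP[j _ ->] /imsetP[k _ Djk]].
  have:= cfdot_cuspidal_principal j k.
  rewrite -(fam_IirrE fC) -(fam_IirrE fT) Djk cfnorm_irr => /eqP.
  by rewrite oner_eq0.
(* [sum_fam] counts both signs of the exponent and takes exponent 0 twice: q nonzero residues of
   degree q - 1 and the Steinberg degree twice here, q - 2 residues of degree q + 1 and the trivial
   degree twice in [sB]. Together they give twice the group order. *)
have sA : 2%:R * (\sum_(i in A) 'chi_i 1%g ^+ 2) = Q * (Q - 1) ^+ 2 + 2%:R * Q ^+ 2.
  rewrite -(sum_fam fC (fun i => 'chi_i 1%g ^+ 2)).
  under eq_bigr do rewrite (fam_IirrE fC) cuspidal1.
  rewrite (fam_IirrE fC) cuspidal1 dvdn0 (sl2_cardC slG) addn1 big_ord_recl /=.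
  rewrite (eq_bigr (fun=> (Q - 1) ^+ 2)) => [|j _]; last first.
    by rewrite gtnNdvd // ?addr0 // /bump /= ltnS.
  by rewrite sumr_const card_ord -mulr_natl -/Q; ring.
have sB : 2%:R * (\sum_(i in B) 'chi_i 1%g ^+ 2) = (Q - 2) * (Q + 1) ^+ 2 + 2%:R.
  rewrite -(sum_fam fT (fun i => 'chi_i 1%g ^+ 2)).
  under eq_bigr do rewrite (fam_IirrE fT) principal1.
  have [m Dm] : exists m, (q - 1)%N = m.+1 by exists (q - 2)%N; rewrite -subSn ?subSS.
  rewrite (fam_IirrE fT) principal1 dvdn0 (sl2_cardT slG) Dm big_ord_recl /=.
  rewrite (eq_bigr (fun=> (Q + 1) ^+ 2)) => [|j _]; last first.
    by rewrite gtnNdvd // /bump /= ltnS.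
  rewrite sumr_const card_ord -(mulr_natl ((Q + 1) ^+ 2)).
  have -> : m%:R = Q - 2.
    by rewrite -[m%:R](addrK 1) natr1 -Dm natrB ?(ltnW q_gt1) // -/Q; ring.
  by ring.
have sG : \sum_i ('chi[G]_i 1%g) ^+ 2 = Q * (Q ^+ 2 - 1).
  rewrite irr_sum_square (sl2_cardG slG) natrM natrB ?expn_gt0 ?(ltnW q_gt1) //.
  by rewrite natrX.
have : \sum_(i | i \notin A :|: B) ('chi[G]_i 1%g) ^+ 2 = 0.
  move: sG; rewrite (bigID (mem (A :|: B))) /=.
  rewrite (eq_bigl [predU A & B]) => [|x]; last by rewrite !inE.
  rewrite bigU //= => sG.
  have nz2 : 2%:R != 0 :> algC by rewrite pnatr_eq0.
  apply: (mulfI nz2); rewrite mulr0.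
  set SA := \sum_(i in A) _ in sA sG; set SB := \sum_(i in B) _ in sB sG.
  set S := \sum_(i | _) _ in sG *.
  have -> : 2%:R * S = 2%:R * (SA + SB + S) - 2%:R * SA - 2%:R * SB by ring.
  by rewrite sG sA sB; ring.
move/eqP; rewrite psumr_eq0 => [|k _]; last by rewrite exprn_ge0 // char1_ge0 ?irr_char.
move/allP/(_ i (mem_index_enum _)); rewrite in_setU (negPf nAi) (negPf nBi) /=.
by rewrite expf_eq0 (negPf (irr1_neq0 i)).
Qed.

End Characters.

(** * The classification *)

Lemma ltn_totient d : (1 < d)%N -> (totient d < d)%N.
Proof.
move=> d_gt1; have d_gt0 := ltnW d_gt1.
rewrite totient_count_coprime big_ltn // [coprime d 0]/coprime gcdn0 gtn_eqF // add0n.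
rewrite -[X in (_ < X)%N](subnKC d_gt0) add1n ltnS -[X in (_ <= X)%N]muln1.
rewrite -sum_nat_const_nat; by apply: leq_sum => i _; apply: leq_b1.
Qed.

Lemma dimA_nat q d m : (0 < q)%N ->
  (m%:R = dimA q d) <-> (2 * m = (q - 1) * totient d)%N.
Proof.
move=> q_gt0; rewrite /dimA -(natrB _ q_gt0).
have nz2 : 2%:R != 0 :> rat by [].
split=> [Dm | Dm].
  by apply/eqP; rewrite -(eqr_nat rat) !natrM Dm; apply/eqP; field.
by apply: (mulfI nz2); rewrite -natrM Dm natrM; field.
Qed.

Lemma dimB_nat q d m : (m%:R = dimB q d) <-> (2 * m = (q + 1) * totient d)%N.
Proof.
rewrite /dimB -(natrD _ q 1).
have nz2 : 2%:R != 0 :> rat by [].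
split=> [Dm | Dm].
  by apply/eqP; rewrite -(eqr_nat rat) !natrM Dm; apply/eqP; field.
by apply: (mulfI nz2); rewrite -natrM Dm natrM; field.
Qed.

Lemma coprime_pred_succ q : odd (q - 1) -> coprime (q - 1) (q + 1).
Proof.
move=> oddq; have q_gt0 : (0 < q)%N by case: q oddq.
have -> : (q + 1 = (q - 1) + 2)%N by lia.
by rewrite /coprime gcdnDl -/(coprime _ _) coprime_sym coprime2n.
Qed.

(** Keeps the Steinberg module out of the family over [setA]. Since q - 1 is odd and prime to q, it
    would divide 2, leaving only q = 2, where phi(d) would have to be 4 with d at most 3. *)
Lemma neq_dimA_q q d : odd (q - 1) -> d \in setA q -> (2 * q <> (q - 1) * totient d)%N.
Proof.
move=> oddq /andP[/andP[d_gt2 le_dq] dq] E.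
have q_gt0 : (0 < q)%N by case: q oddq {E le_dq dq}.
have : (q - 1 %| 2)%N.
  have co : coprime (q - 1) q by rewrite -{2}(subnK q_gt0) /coprime gcdnDl gcdn1.
  by rewrite -(Gauss_dvdl _ co) E dvdn_mulr.
have := ltn_totient (ltnW d_gt2).
case: (q - 1)%N (erefl (q - 1)%N) oddq E => [|[|[|m]]] //= Dq _ E ltd _.
have q2 : q = 2 by lia.
by rewrite q2 in E le_dq; lia.
Qed.

(** Keeps the two families apart: q - 1 is prime to q + 1, so it would divide phi(d'), which is
    smaller than d' and hence than q - 1. *)
Lemma neq_dimA_dimB q d d' : odd (q - 1) -> d' \in setB q ->
  ((q + 1) * totient d' <> (q - 1) * totient d)%N.
Proof.
move=> oddq /andP[/andP[d_gt2 le_dq] dq] E.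
have : (q - 1 %| totient d')%N.
  by rewrite -(Gauss_dvdr _ (coprime_pred_succ oddq)) E dvdn_mulr.
have t_gt0 : (0 < totient d')%N by rewrite totient_gt0; lia.
move/(dvdn_leq t_gt0); have := ltn_totient (ltnW d_gt2); lia.
Qed.

Lemma neq_dimB_q q d : (1 < q)%N -> (2 * q <> (q + 1) * totient d)%N.
Proof.
move=> q_gt1 E.
have co : coprime (q + 1) q by rewrite coprime_sym /coprime gcdnDl gcdn1.
have : (q + 1 %| 2)%N by rewrite -(Gauss_dvdl _ co) E dvdn_mulr.
by move/dvdn_leq; lia.
Qed.

(** The scalar product is a sum of products of nonnegative multiplicities, so a common constituent
    cannot cancel. *)
Lemma cfdot_char_constt_neq0 (gT : finGroupType) (G : {group gT}) (phi psi : 'CF(G)) i :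
  phi \is a character -> psi \is a character ->
  '[phi, 'chi_i] != 0 -> '[psi, 'chi_i] != 0 -> '[phi, psi] != 0.
Proof.
move=> Nphi Npsi phi_i psi_i; rewrite cfdot_sum_irr.
have ge0 j : 0 <= '[phi, 'chi_j] * ('[psi, 'chi_j])^*.
  by rewrite mulr_ge0 ?conjC_ge0 // natr_ge0 // Cnat_cfdot_char_irr.
rewrite (bigD1 i) //= paddr_eq0 ?sumr_ge0 ?ge0 // negb_and.
by rewrite mulf_neq0 // conjC_eq0.
Qed.

Section Classification.
Variables (q : nat) (gT : finGroupType) (G U T C : {group gT}).
Hypothesis slG : sl2_like q G U T C.

Let q_gt1 := sl2_q slG.
Let q_gt0 := ltnW q_gt1.
Let Q : algC := q%:R.

Definition rational_classification : Prop :=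
  (exists M : QGmodule G,
     [/\ qtrivial M, qdim M = 1%N
       & forall N : QGmodule G,
           qtrivial N -> qdim N = 1%N -> qiso N M])
  /\
  (exists M : QGmodule G,
     [/\ steinberg_module q M, qdim M = q
       & forall N : QGmodule G, steinberg_module q N -> qiso N M])
  /\
  (exists V : nat -> QGmodule G,
     [/\ forall d, d \in setA q ->
           qsimple (V d) /\ (qdim (V d))%:R = dimA q d,
         forall d d', d \in setA q -> d' \in setA q ->
           qiso (V d) (V d') -> d = d'
       & forall d (M : QGmodule G), d \in setA q ->
           qsimple M -> (qdim M)%:R = dimA q d ->
           qtrivial M \/ (exists2 d', d' \in setA q & qiso M (V d'))])
  /\
  (exists W : nat -> QGmodule G,
     [/\ forall d, d \in setB q ->
           qsimple (W d) /\ (qdim (W d))%:R = dimB q d,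
         forall d d', d \in setB q -> d' \in setB q ->
           qiso (W d) (W d') -> d = d'
       & forall d (M : QGmodule G), d \in setB q ->
           qsimple M -> (qdim M)%:R = dimB q d ->
           exists2 d', d' \in setB q & qiso M (W d')])
  /\
  (exists s : seq 'CF(G),
     [/\ uniq s, forall chi, (chi \in s) <-> Irr_rat chi
       & size s = (tau (q - 1) + tau (q + 1))%N]).

Theorem sl2_like_classification : rational_classification.
Proof.
have [mu [Lmu mu1 muQ]] := sl2_mu slG.
have [lamT LT T1] := cyclic_lin_char (torus_cyclic (sl2_T slG)).
have [lamC LC C1] := cyclic_lin_char (torus_cyclic (sl2_C slG)).
pose X := cuspidal G mu lamC; pose Y := principal G mu lamT.
have cT := sl2_cardT slG; have cC := sl2_cardC slG.
have fX : torus_family #|C| X by apply: (cuspidal_family slG).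
have fY : torus_family #|T| Y by apply: (principal_family slG).
have oddC := fam_odd fX; have oddT := fam_odd fY; rewrite cC in oddC; rewrite cT in oddT.
have XY j k : '[X j, Y k] = 0 by apply: (cfdot_cuspidal_principal slG).
have X1 j : X j 1%g = Q - 1 + (#|C| %| j)%N%:R by apply: (cuspidal1 slG).
have Y1 j : Y j 1%g = if (#|T| %| j)%N then 1 else Q + 1 by apply: (principal1 slG).
have complete i : (exists j, 'chi[G]_i = X j) \/ (exists j, 'chi_i = Y j).
  exact: (cuspidal_principal_complete slG).
have [V DV] := fam_qmodules fX; have [W DW] := fam_qmodules fY.
have simV d : (d %| q + 1)%N -> qsimple (V d) by rewrite -cC => /DV[].
have simW d : (d %| q - 1)%N -> qsimple (W d) by rewrite -cT => /DW[].
have VX d j : (d %| q + 1)%N -> '[qchar (V d), X j] = (ordmod #|C| j == d)%:R.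
  by rewrite -cC => /DV[_ ->]; apply: (cfdot_fam_block fX).
have WY d j : (d %| q - 1)%N -> '[qchar (W d), Y j] = (ordmod #|T| j == d)%:R.
  by rewrite -cT => /DW[_ ->]; apply: (cfdot_fam_block fY).
have VY d j : (d %| q + 1)%N -> '[qchar (V d), Y j] = 0.
  rewrite -cC => /DV[_ ->]; rewrite cfdot_suml big1 // => i /imsetP[k _ ->].
  by rewrite (fam_IirrE fX).
have injV d d' : (d %| q + 1)%N -> (d' %| q + 1)%N -> qchar (V d) = qchar (V d') -> d = d'.
  move=> dn d'n E; have := VX d (#|C| %/ d)%N dn; rewrite E VX // ordmod_div ?cardG_gt0 ?cC // eqxx.
  by move/eqP; rewrite eqr_nat; case: (d =P d').
have injW d d' : (d %| q - 1)%N -> (d' %| q - 1)%N -> qchar (W d) = qchar (W d') -> d = d'.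
  move=> dn d'n E; have := WY d (#|T| %/ d)%N dn; rewrite E WY // ordmod_div ?cardG_gt0 ?cT // eqxx.
  by move/eqP; rewrite eqr_nat; case: (d =P d').
have VW d d' : (d %| q + 1)%N -> (d' %| q - 1)%N -> qchar (V d) != qchar (W d').
  move=> dn d'n; apply/eqP=> E; have := VY d (#|T| %/ d')%N dn.
  rewrite E WY // ordmod_div ?cardG_gt0 ?cT // eqxx.
  by move/eqP; rewrite oner_eq0.
(* Some irreducible character occurs in [M]; it also occurs in some [V d] or [W d], and a common
   constituent makes simple rational modules isomorphic. *)
have classify M : qsimple M ->
    (exists2 d, (d %| q + 1)%N & qiso M (V d)) \/ (exists2 d, (d %| q - 1)%N & qiso M (W d)).
  move=> simM; have [i Mi] : exists i, '[qchar M, 'chi_i] != 0.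
    apply/existsP; apply: contraT; rewrite negb_exists => /forallP all0.
    have := qchar1 M; rewrite [qchar M]cfun_sum_cfdot big1 => [|i _].
      by rewrite cfunE => /esym/eqP; rewrite pnatr_eq0 -leqn0 leqNgt qdim_gt0.
    by have /negPn/eqP-> := all0 i; rewrite scale0r.
  have [[j Dj] | [j Dj]] := complete i; [left | right].
    have dn : (ordmod #|C| j %| q + 1)%N by rewrite -cC ordmod_dvd.
    exists (ordmod #|C| j) => //; apply: qiso_cfdot (simV _ dn) _ => //.
    apply: (cfdot_char_constt_neq0 (i := i)); rewrite ?qchar_char //.
    by rewrite Dj VX // eqxx oner_eq0.
  have dn : (ordmod #|T| j %| q - 1)%N by rewrite -cT ordmod_dvd.
  exists (ordmod #|T| j) => //; apply: qiso_cfdot (simW _ dn) _ => //.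
  apply: (cfdot_char_constt_neq0 (i := i)); rewrite ?qchar_char //.
  by rewrite Dj WY // eqxx oner_eq0.
have ord1 n j : (0 < n)%N -> (ordmod n j == 1)%N = (n %| j)%N.
  move=> n_gt0; have g_gt0 : (0 < gcdn j n)%N by rewrite gcdn_gt0 n_gt0 orbT.
  rewrite /ordmod -(eqn_pmul2r g_gt0) divnK ?dvdn_gcdr // mul1n eq_sym.
  apply/eqP/idP=> [E | nj]; last exact/gcdn_idPr.
  by rewrite -E dvdn_gcdl.
have natC_inj (a b : nat) : a%:R = b%:R :> algC -> a = b by move/eqP; rewrite eqr_nat => /eqP.
have dimV d : (d %| q + 1)%N -> (1 < d)%N -> (2 * qdim (V d) = (q - 1) * totient d)%N.
  move=> dn d_gt1; have dn' := dn; rewrite -cC in dn'.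
  have E : qdim (V d) = (#|fam_block #|C| X d| * (q - 1))%N.
    apply: natC_inj; have [_ DVd] := DV d dn'; rewrite -qchar1 DVd.
    rewrite (fam_block1 fX (c := Q - 1)) ?natrM ?natrB // => j ord_j.
    by rewrite X1 -ord1 ?cardG_gt0 // ord_j gtn_eqF // addr0.
  have := card_fam_block fX dn'; rewrite gtn_eqF // addn0 E => <-.
  by rewrite mulnA mulnC.
have dimW d : (d %| q - 1)%N -> (1 < d)%N -> (2 * qdim (W d) = (q + 1) * totient d)%N.
  move=> dn d_gt1; have dn' := dn; rewrite -cT in dn'.
  have E : qdim (W d) = (#|fam_block #|T| Y d| * (q + 1))%N.
    apply: natC_inj; have [_ DWd] := DW d dn'; rewrite -qchar1 DWd.
    rewrite (fam_block1 fY (c := Q + 1)) ?natrM ?natrD // => j ord_j.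
    by rewrite Y1 -ord1 ?cardG_gt0 // ord_j gtn_eqF.
  have := card_fam_block fY dn'; rewrite gtn_eqF // addn0 E => <-.
  by rewrite mulnA mulnC.
(* The index 1 lies outside [setA] and [setB]; it carries the Steinberg module in [V] and the
   trivial one in [W]. *)
have charV1 : qchar (V 1%N) = X 0%N.
  have [_ ->] := DV 1%N (dvd1n _); rewrite (fam_block_one fX) big_set1.
  exact: (fam_IirrE fX).
have charW1 : qchar (W 1%N) = 1.
  have [_ ->] := DW 1%N (dvd1n _); rewrite (fam_block_one fY) big_set1.
  by rewrite (fam_IirrE fY) /Y /principal dvdn0.
have dimV1 : qdim (V 1%N) = q.
  by apply: natC_inj; rewrite -qchar1 charV1 X1 dvdn0 subrK.
have dimW1 : qdim (W 1%N) = 1%N.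
  by apply: natC_inj; rewrite -qchar1 charW1 cfun11.
have trivW1 M : qiso M (W 1%N) -> qtrivial M.
  move=> isoM; apply: qtrivial_qiso; apply: mx_rsim_trans isoM _.
  apply: (qiso_cfdot (simW _ (dvd1n _)) (qsimple_trivial G)).
  by rewrite charW1 qchar_trivial cfnorm1 oner_eq0.
have qdim_iso (M N : QGmodule G) : qiso M N -> qdim M = qdim N by case.
have setA_dvd d : d \in setA q -> (d %| q + 1)%N by case/andP.
have setB_dvd d : d \in setB q -> (d %| q - 1)%N by case/andP.
have setA_gt1 d : d \in setA q -> (1 < d)%N by case/andP=> /andP[/ltnW].
have setB_gt1 d : d \in setB q -> (1 < d)%N by case/andP=> /andP[/ltnW].
(* As q - 1 and q + 1 are odd, 2 divides neither, so excluding d = 1 already gives 2 < d. *)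
have oddgt2 d : odd d -> d != 1%N -> (2 < d)%N by case: d => [|[|[|]]].
have setAE d : (d %| q + 1)%N -> d != 1%N -> d \in setA q.
  move=> dn d1; apply/andP; split=> //; apply/andP; split.
    exact: oddgt2 (dvdn_odd dn oddC) d1.
  by apply: dvdn_leq dn; rewrite addn1.
have setBE d : (d %| q - 1)%N -> d != 1%N -> d \in setB q.
  move=> dn d1; apply/andP; split=> //; apply/andP; split.
    exact: oddgt2 (dvdn_odd dn oddT) d1.
  by apply: dvdn_leq dn; rewrite subn_gt0.
split; last split; last split; last split.
- exists (trivial_module G); split=> // N; apply: qiso_trivial.
(* The degrees are 1, q - 1, q and q + 1, and q occurs only at exponents divisible by q + 1, which
   all give the same character. *)
- have steinbergX psi : psi \in irr G -> psi 1%g = q%:R -> psi = X 0%N.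
    case/irrP=> i -> chi1; have [[j Dj] | [j Dj]] := complete i.
      rewrite Dj -!(fam_IirrE fX); congr 'chi_ _; apply/eqP.
      rewrite (eq_fam_Iirr fX) /eqpm addn0; apply/orP; right.
      move: chi1; rewrite Dj X1; case: (_ %| j)%N => // /eqP.
      by rewrite addr0 -subr_eq0 addrAC subrr add0r oppr_eq0 oner_eq0.
    move: chi1; rewrite Dj Y1; case: ifP => _ /eqP.
      by rewrite -[1]/(1%:R) eqr_nat ltn_eqF.
    by rewrite -subr_eq0 addrAC subrr add0r oner_eq0.
  exists (V 1%N); split=> //.
    split; first exact: simV (dvd1n _).
    rewrite charV1; split=> //; first exact: fam_irr fX _.
    by rewrite X1 dvdn0 subrK.
  move=> N [simN [irrN N1 _]]; apply: qiso_cfdot (simV _ (dvd1n _)) _ => //.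
  rewrite charV1 (steinbergX _ irrN N1) (fam_dot fX) /eqpm eqxx.
  exact: oner_neq0.
- exists V; split.
  + move=> d Ad; split; first exact/simV/setA_dvd.
    by apply/dimA_nat/dimV; auto.
  + by move=> d d' Ad Ad' /qiso_qchar; apply: injV; auto.
  move=> d M Ad simM /dimA_nat => /(_ q_gt0) dimM.
  have [[d' d'n isoM] | [d' d'n isoM]] := classify M simM; have [d'1 | d'1] := eqVneq d' 1%N.
  + rewrite (qdim_iso _ _ isoM) d'1 dimV1 in dimM.
    by case: (neq_dimA_q oddT Ad dimM).
  + by right; exists d' => //; apply: setAE.
  + by left; apply: trivW1; rewrite -d'1.
  rewrite (qdim_iso _ _ isoM) dimW ?(setB_gt1 d') ?setBE // in dimM.
  by case: (neq_dimA_dimB oddT (setBE _ d'n d'1) dimM).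
- exists W; split.
  + move=> d Bd; split; first exact/simW/setB_dvd.
    by apply/dimB_nat/dimW; auto.
  + by move=> d d' Bd Bd' /qiso_qchar; apply: injW; auto.
  move=> d M Bd simM /dimB_nat dimM.
  have [[d' d'n isoM] | [d' d'n isoM]] := classify M simM; have [d'1 | d'1] := eqVneq d' 1%N.
  + rewrite (qdim_iso _ _ isoM) d'1 dimV1 in dimM.
    by case: (neq_dimB_q q_gt1 dimM).
  + rewrite (qdim_iso _ _ isoM) dimV ?(setA_gt1 d') ?setAE // in dimM.
    by case: (neq_dimA_dimB oddT Bd (esym dimM)).
  + rewrite (qdim_iso _ _ isoM) d'1 dimW1 in dimM.
    have : (0 < totient d)%N by rewrite totient_gt0 ltnW ?setB_gt1.
    by case: (totient d) dimM => // t; rewrite mulnS; move: q_gt1; lia.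
  by exists d' => //; apply: setBE.
pose sV := [seq qchar (V d) | d <- divisors (q + 1)].
pose sW := [seq qchar (W d) | d <- divisors (q - 1)].
have q1_gt0 : (0 < q + 1)%N by rewrite addn1.
have q'_gt0 : (0 < q - 1)%N by rewrite subn_gt0.
exists (sV ++ sW); split.
- rewrite cat_uniq !map_inj_in_uniq ?divisors_uniq /=; last first.
  + by move=> d d'; rewrite -!dvdn_divisors //; apply: injV.
  + by move=> d d'; rewrite -!dvdn_divisors //; apply: injW.
  rewrite andbT; apply/hasPn=> x /mapP[d']; rewrite -dvdn_divisors // => d'n ->.
  apply/negP=> /mapP[d]; rewrite -dvdn_divisors // => dn /esym/eqP.
  exact/negP/VW.
- move=> chi; rewrite mem_cat; split=> [/orP[]/mapP[d] | [M simM ->]].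
  + by rewrite -dvdn_divisors // => dn ->; exists (V d); auto.
  + by rewrite -dvdn_divisors // => dn ->; exists (W d); auto.
  have [[d dn /qiso_qchar->] | [d dn /qiso_qchar->]] := classify M simM.
    by apply/orP; left; apply/map_f; rewrite -dvdn_divisors.
  by apply/orP; right; apply/map_f; rewrite -dvdn_divisors.
by rewrite size_cat !size_map addnC.
Qed.

End Classification.

(** * SL_2 in characteristic 2 *)

Section Matrix2.
Variable R : comNzRingType.

Definition mx2 (a b c d : R) : 'M[R]_2 :=
  \matrix_(i, j) (if i == 0 then if j == 0 then a else b else if j == 0 then c else d).

Lemma eq_mx2 (A B : 'M[R]_2) :
  A 0 0 = B 0 0 -> A 0 1 = B 0 1 -> A 1 0 = B 1 0 -> A 1 1 = B 1 1 -> A = B.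
Proof.
move=> e00 e01 e10 e11; apply/matrixP=> i j.
have ord2 (l : 'I_2) : l = 0 \/ l = 1 by case: l => [[|[|//]] lt]; [left | right]; apply: val_inj.
by case: (ord2 i) => ->; case: (ord2 j) => ->.
Qed.

Lemma mx2E a b c d : [/\ mx2 a b c d 0 0 = a, mx2 a b c d 0 1 = b,
  mx2 a b c d 1 0 = c & mx2 a b c d 1 1 = d].
Proof. by rewrite !mxE. Qed.

Lemma mx2_1E : [/\ (1%:M : 'M[R]_2) 0 0 = 1, (1%:M : 'M[R]_2) 0 1 = 0,
  (1%:M : 'M[R]_2) 1 0 = 0 & (1%:M : 'M[R]_2) 1 1 = 1].
Proof. by rewrite !mxE. Qed.

Lemma mulmx2E (A B : 'M[R]_2) i j : (A *m B) i j = A i 0 * B 0 j + A i 1 * B 1 j.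
Proof.
rewrite mxE big_ord_recl big_ord1 (_ : lift ord0 ord0 = 1 :> 'I_2) //.
exact: val_inj.
Qed.

Lemma det_mx2 (A : 'M[R]_2) : \det A = A 0 0 * A 1 1 - A 0 1 * A 1 0.
Proof.
have l01 : lift 0 0 = 1 :> 'I_2 by apply: val_inj.
have l10 : lift 1 0 = 0 :> 'I_2 by apply: val_inj.
rewrite (expand_det_row _ 0) big_ord_recl big_ord1 (_ : lift ord0 ord0 = 1 :> 'I_2) //.
rewrite /cofactor !det_mx11 !mxE l01 l10 expr0 mul1r expr1 mulN1r mulrN //.
Qed.

Lemma mxtrace2 (A : 'M[R]_2) : \tr A = A 0 0 + A 1 1.
Proof.
rewrite /mxtrace big_ord_recl big_ord1 (_ : lift ord0 ord0 = 1 :> 'I_2) //.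
exact: val_inj.
Qed.

End Matrix2.

Section Char2.
Variables (F : finFieldType) (k : nat).
Hypotheses (k_gt0 : (0 < k)%N) (cardF : #|F| = (2 ^ k)%N).

Lemma pchar2 : 2 \in [pchar F].
Proof.
rewrite inE /=; have: (#|F|%:R : F) = 0.
  by have := expg_cardG (in_setT (1 : F)); rewrite FinRing.zmodXgE cardsT.
by rewrite cardF natrX => /eqP; rewrite expf_eq0 k_gt0.
Qed.

Let addxx (x : F) : x + x = 0. Proof. exact: addrr_pchar2 pchar2 x. Qed.
Let oppx (x : F) : - x = x. Proof. exact: oppr_pchar2 pchar2 x. Qed.

Lemma sqr_inj2 : injective (fun x : F => x ^+ 2).
Proof.
move=> x y /= /eqP; rewrite -subr_eq0 subr_sqr (oppx y) -expr2 sqrf_eq0 addr_eq0 oppx.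
by move/eqP.
Qed.

Lemma sqrt2 (a : F) : exists s, s ^+ 2 = a.
Proof. by have [g _ gK] := injF_bij sqr_inj2; exists (g a); rewrite gK. Qed.

(* The norm form of [F[X] / (X^2 + t X + 1)]. *)
Definition nform (t x y : F) := x ^+ 2 + x * y * t + y ^+ 2.

Definition roots2 t := [set x : F | nform t x 1 == 0].
Definition nform1 t := [set z : F * F | nform t z.1 z.2 == 1].

(* Squaring is bijective, so every pair with nonzero norm is in a unique way a
   scalar multiple of a pair of norm 1. *)
Lemma card_nform1 t : (#|nform1 t| + #|roots2 t| = #|F| + 1)%N.
Proof.
pose q := #|F|; have q_gt1 : (1 < q)%N by rewrite /q cardF -{1}(expn0 2) ltn_exp2l.
pose Z := [set z : F * F | nform t z.1 z.2 == 0].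
have cardZ : #|Z| = (1 + (q - 1) * #|roots2 t|)%N.
  rewrite -sum1_card (eq_bigl (fun z => nform t z.1 z.2 == 0)) => [|z]; last by rewrite inE.
  rewrite -(pair_big_dep xpredT (fun x y => nform t x y == 0) (fun _ _ => 1%N)) /=.
  rewrite (exchange_big_dep xpredT) //= (bigD1 0) //=; congr (_ + _)%N.
    rewrite sum1dep_card -(cards1 (0 : F)); apply: eq_card => x; rewrite !inE.
    by rewrite /nform mulr0 mul0r expr0n !addr0 expf_eq0.
  rewrite (eq_bigr (fun=> #|roots2 t|)) => [|y nzy].
    rewrite sum_nat_const; congr (_ * _)%N.
    by rewrite /q subn1 -(cardC1 (0 : F)); apply: eq_card => y.
  rewrite sum1dep_card -[in RHS](card_imset _ (mulIf nzy)); apply: eq_card => x; rewrite inE.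
  apply/idP/imsetP=> [xy0 | [u]].
    exists (x / y); last by rewrite divfK.
    have Dx : nform t (x / y) 1 = nform t x y / y ^+ 2 by rewrite /nform; field.
    by rewrite inE Dx (eqP xy0) mul0r.
  rewrite inE => /eqP u0 ->; have -> : nform t (u * y) y = nform t u 1 * y ^+ 2.
    by rewrite /nform; ring.
  by rewrite u0 mul0r.
have cardNZ : #|~: Z| = ((q - 1) * #|nform1 t|)%N.
  pose f (w : F * (F * F)) := (w.1 * w.2.1, w.1 * w.2.2).
  have Df s x y : nform t (s * x) (s * y) = s ^+ 2 * nform t x y by rewrite /nform; ring.
  have -> : ((q - 1) * #|nform1 t| = #|setX [set~ (0%R : F)] (nform1 t)|)%N.
    by rewrite cardsX cardsC1 subn1.
  rewrite -(card_in_imset (f := f)).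
    apply: eq_card => [[x y]]; rewrite !inE /=; apply/idP/imsetP=> [nz | [[s [u v]]]].
      have [s Ds] := sqrt2 (nform t x y).
      have nzs : s != 0 by apply: contraNneq nz => s0; rewrite -Ds s0 expr0n.
      exists (s, (s^-1 * x, s^-1 * y)); last by rewrite /f /= !mulVKf.
      by rewrite !inE /= nzs Df exprVn Ds mulVf ?eqxx.
    rewrite !inE /= => /andP[nzs /eqP uv1] [-> ->]; rewrite Df uv1 mulr1.
    by rewrite expf_eq0.
  move=> [s [x y]] [s' [x' y']];
    rewrite !inE /= => /andP[nzs /eqP xy1] /andP[nzs' /eqP xy1'] [Ex Ey].
  have ss' : s = s'.
    by apply: sqr_inj2; rewrite -[s ^+ 2]mulr1 -xy1 -Df Ex Ey Df xy1' mulr1.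
  by rewrite -ss' in Ex Ey; rewrite (mulfI nzs Ex) (mulfI nzs Ey) ss'.
have := cardsC Z; rewrite cardZ cardNZ card_prod -/q.
move=> E; apply/eqP; rewrite -(eqn_pmul2l (_ : (0 < q - 1)%N)) ?subn_gt0 //; apply/eqP.
move: E; case: q q_gt1 {cardZ cardNZ} => // p _; rewrite subn1 /=; nia.
Qed.

Notation G := (SL2_group F).
Implicit Types (g h x y : {'GL_2[F]}) (A B : 'M[F]_2).

(* Entries of elements of ['GL_2] are indexed by ['I_2.-1.+1]; this cast makes
   the lemmas on 2 x 2 matrices match syntactically. *)
Definition mxof (g : {'GL_2[F]}) : 'M[F]_2 := GLval g.

Lemma mxofM x y : mxof (x * y)%g = mxof x *m mxof y.
Proof. by []. Qed.

Lemma mxof1 : mxof 1%g = 1%:M.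
Proof. by []. Qed.

Lemma SL2P g : reflect (\det (mxof g) = 1) (g \in G).
Proof. by rewrite inE; apply: eqP. Qed.

Lemma SL2_exists A : \det A = 1 -> exists2 g, g \in G & mxof g = A.
Proof.
move=> dA; have uA : (A : 'M[F]_2.-1.+1) \in unitmx by rewrite unitmxE dA unitr1.
by exists (FinRing.unit _ uA); first apply/SL2P.
Qed.

Lemma mxof_inj : injective mxof. Proof. exact: val_inj. Qed.

Definition companion (t : F) : 'M[F]_2 := mx2 0 1 (-1) t.

Lemma det_companion t : \det (companion t) = 1.
Proof. by rewrite det_mx2; have [-> -> -> ->] := mx2E (0 : F) 1 (-1) t; ring. Qed.

(** The diagonal entry has square 1, and squaring is injective. *)
Lemma SL2_scalar g : g \in G -> mxof g 0 1 = 0 -> mxof g 1 0 = 0 ->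
  mxof g 0 0 = mxof g 1 1 -> g = 1%g.
Proof.
move=> /SL2P; rewrite det_mx2 => dg e01 e10 e00.
have a1 : mxof g 1 1 = 1.
  by apply: sqr_inj2; rewrite expr1n -dg e01 mul0r subr0 e00.
by apply/mxof_inj/eq_mx2; rewrite ?e00 ?e01 ?e10 ?a1 mxof1 !mxE.
Qed.

(** In the basis v, v g, for a row vector v that is not an eigenvector, [g] becomes a companion
    matrix. The base change has determinant [D]; scaling by a square root of [D^-1] puts it into
    SL_2. *)
Lemma companion_conj g : g \in G -> g != 1%g ->
  exists2 p, p \in G & mxof (g ^ p) = companion (\tr (mxof g)).
Proof.
move=> Gg ntg; have dg := SL2P g Gg; rewrite det_mx2 in dg.
set a := mxof g 0 0 in dg; set b := mxof g 0 1 in dg.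
set c := mxof g 1 0 in dg; set d := mxof g 1 1 in dg.
(* The expression is the determinant of the rows v and v g. If (1, 0), (0, 1) and (1, 1) were all
   eigenvectors, [g] would be scalar. *)
have [v0 [v1 nz]] : exists v0 v1, v0 ^+ 2 * b + v0 * v1 * (d - a) - v1 ^+ 2 * c != 0.
  have [b0 | nzb] := eqVneq b 0; last by exists 1, 0; rewrite expr0n expr1n; move: nzb;
    rewrite !(mulr0, mul0r, mul1r, addr0, subr0).
  have [c0 | nzc] := eqVneq c 0; last by exists 0, 1;
    rewrite expr0n expr1n !(mulr0, mul0r, mul1r, addr0, sub0r) oppr_eq0.
  exists 1, 1; rewrite b0 c0 expr1n !(mul1r, mulr0, subr0, add0r) subr_eq0.
  by apply: contra ntg => /eqP da; apply/eqP/SL2_scalar.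
set D := _ - _ in nz; have [s Ds] := sqrt2 D^-1.
have [|p Gp Dp] := SL2_exists (A := s *: mx2 v0 v1 (v0 * a + v1 * c) (v0 * b + v1 * d)).
  by rewrite detZ Ds det_mx2; have
    [-> -> -> ->] := mx2E v0 v1 (v0 * a + v1 * c) (v0 * b + v1 * d);
    rewrite -[RHS](mulVf nz) /D; ring.
exists p^-1%g; first by rewrite groupV.
(* The second row is the Cayley-Hamilton relation applied to v. *)
have E : mxof p *m mxof g = companion (\tr (mxof g)) *m mxof p.
  rewrite Dp -scalemxAl -scalemxAr; congr (_ *: _).
  rewrite mxtrace2 -/a -/d.
  have [m0 m1 m2 m3] := mx2E v0 v1 (v0 * a + v1 * c) (v0 * b + v1 * d).
  have [n0 n1 n2 n3] := mx2E (0 : F) 1 (-1) (a + d).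
  have dg' : a * d = 1 + b * c by rewrite -dg subrK.
  apply: eq_mx2; rewrite !mulmx2E ?m0 ?m1 ?m2 ?m3 ?n0 ?n1 ?n2 ?n3 -/a -/b -/c -/d.
  - by ring.
  - by ring.
  - ring: dg'.
  - ring: dg'.
have <- : mxof p *m mxof g *m invmx (mxof p) = companion (\tr (mxof g)).
  by rewrite E mulmxK // unitmxE (SL2P p Gp) unitr1.
by rewrite conjgE invgK mulgA.
Qed.

Lemma companionE t : [/\ companion t 0 0 = 0, companion t 0 1 = 1,
  companion t 1 0 = -1 & companion t 1 1 = t].
Proof. exact: mx2E. Qed.

Lemma mxofE x y i j : mxof (x * y)%g i j = mxof x i 0 * mxof y 0 j + mxof x i 1 * mxof y 1 j.
Proof. by rewrite mxofM mulmx2E. Qed.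

Lemma eq_SL2_trace g h : g \in G -> h \in G -> g != 1%g -> h != 1%g ->
  \tr (mxof g) = \tr (mxof h) -> h \in g ^: G.
Proof.
move=> Gg Gh ntg nth eq_tr.
have [p Gp Dp] := companion_conj Gg ntg; have [r Gr Dr] := companion_conj Gh nth.
have E : (g ^ p = h ^ r)%g by apply: mxof_inj; rewrite Dp Dr eq_tr.
by apply/imsetP; exists (p * r^-1)%g; rewrite ?groupM ?groupV // conjgM E conjgK.
Qed.

Lemma mxtraceJ_SL2 x y : \tr (mxof (x ^ y)%g) = \tr (mxof x).
Proof.
by rewrite conjgE !mxofM mxtrace_mulC -mulmxA -mxofM mulgV mxof1 mulmx1.
Qed.

Section Companion.
Variables (t : F) (c : {'GL_2[F]}).
Hypothesis Dc : mxof c = companion t.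

(** These are the matrices a + b c, with a and b the entries of the first row; their determinant is
    [nform t a b]. *)
Lemma cent1_companionP x : reflect
  [/\ x \in G, mxof x 1 0 = - mxof x 0 1 & mxof x 1 1 = mxof x 0 0 + t * mxof x 0 1]
  (x \in 'C_G[c]%g).
Proof.
have [c0 c1 c2 c3] := companionE t.
apply: (iffP setIP) => [[Gx /cent1P xc] | [Gx e10 e11]]; split=> //.
- by have := congr1 (fun z : {'GL_2[F]} => mxof z 0 0) xc;
    rewrite !mxofE Dc c0 c1 c2 mulr0 add0r mulrN1 mul0r add0r mul1r.
- by have := congr1 (fun z : {'GL_2[F]} => mxof z 0 1) xc;
    rewrite !mxofE Dc c0 c1 c3 mulr1 mul0r add0r mul1r mulrC.
apply/cent1P/mxof_inj/eq_mx2; rewrite !mxofE Dc ?c0 ?c1 ?c2 ?c3 ?e10 ?e11; ring.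
Qed.

Lemma det_cent1_companion x : x \in 'C_G[c]%g -> nform t (mxof x 0 0) (mxof x 0 1) = 1.
Proof.
case/cent1_companionP=> /SL2P; rewrite det_mx2 => dx e10 e11.
by rewrite -dx e10 e11 /nform; ring.
Qed.

Lemma card_cent1_companion : #|'C_G[c]%g| = #|nform1 t|.
Proof.
rewrite -(card_in_imset (f := fun x => (mxof x 0 0, mxof x 0 1))).
  apply: eq_card => [[a b]]; rewrite inE /=; apply/imsetP/eqP=> [[x Cx [-> ->]] | nab].
    exact: det_cent1_companion.
  have [e0 e1 e2 e3] := mx2E a b (- b) (a + t * b).
  have [|x Gx Dx] := SL2_exists (A := mx2 a b (- b) (a + t * b)).
    by rewrite det_mx2 e0 e1 e2 e3 -nab /nform; ring.
  exists x; last by rewrite Dx e0 e1.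
  by apply/cent1_companionP; rewrite Dx e0 e1 e2 e3.
move=> x y /cent1_companionP[_ x10 x11] /cent1_companionP[_ y10 y11] [e0 e1].
by apply/mxof_inj/eq_mx2 => //; rewrite ?x10 ?x11 ?y10 ?y11 ?e0 ?e1.
Qed.

Lemma cent1_companion_abelian : abelian 'C_G[c]%g.
Proof.
apply/centsP=> x /cent1_companionP[_ x10 x11] y /cent1_companionP[_ y10 y11].
by apply/mxof_inj/eq_mx2; rewrite !mxofE ?x10 ?x11 ?y10 ?y11; ring.
Qed.

Lemma cent1_companion_nontriv x : x \in ('C_G[c]^#)%g -> mxof x 0 1 != 0.
Proof.
case/setD1P=> ntx /cent1_companionP[Gx x10 x11]; apply: contra ntx => /eqP b0.
by apply/eqP/SL2_scalar; rewrite ?x10 ?x11 ?b0 ?oppr0 ?mulr0 ?addr0.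
Qed.

(** Here x = a + b c with b nonzero, so commuting with [x] amounts to commuting with [c]. *)
Lemma cent1_cent1_companion x : x \in ('C_G[c]^#)%g -> ('C_G[x] = 'C_G[c])%g.
Proof.
move=> Cx1; have nzb := cent1_companion_nontriv Cx1; have [ntx Cx] := setD1P Cx1.
have [Gx x10 x11] := cent1_companionP _ Cx.
apply/eqP; rewrite eqEsubset; apply/andP; split; last first.
  apply/subsetP=> y Cy; rewrite inE; have [-> _] := setIP Cy.
  by apply/cent1P; apply: (centsP cent1_companion_abelian).
apply/subsetP=> y /setIP[Gy /cent1P yx]; apply/cent1_companionP; split=> //.
  apply: (mulfI nzb).
  have := congr1 (fun z : {'GL_2[F]} => mxof z 0 0) yx; rewrite !mxofE x10 => E.
  apply/eqP; rewrite -subr_eq0 -[X in _ == X](subrr (mxof y 0 0 * mxof x 0 0 + mxof y 0 1 *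
    - mxof x 0 1)) {1}E.
  by apply/eqP; ring.
apply: (mulfI nzb).
have := congr1 (fun z : {'GL_2[F]} => mxof z 0 1) yx; rewrite !mxofE x11 => E.
apply/eqP; rewrite -subr_eq0 -[X in _ == X](subrr (mxof y 0 0 * mxof x 0 1 + mxof y 0 1 * (mxof
  x 0 0 + t * mxof x 0 1))) {1}E.
by apply/eqP; ring.
Qed.

End Companion.

(** The inverse is the adjugate matrix. With [eq_SL2_trace] this makes every element conjugate to
    its inverse. *)
Lemma mxtraceV_SL2 x : x \in G -> \tr (mxof x^-1%g) = \tr (mxof x).
Proof.
have [u0 u1 u2 u3] := mx2_1E F; move=> /SL2P dx; have := dx; rewrite det_mx2 => dx2.
have [e0 e1 e2 e3] := mx2E (mxof x 1 1) (- mxof x 0 1) (- mxof x 1 0) (mxof x 0 0).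
have [|y _ Dy] := SL2_exists (A := mx2 (mxof x 1 1) (- mxof x 0 1) (- mxof x 1 0) (mxof x 0 0)).
  by rewrite det_mx2 e0 e1 e2 e3 -dx2; ring.
suff -> : (x^-1 = y)%g by rewrite !mxtrace2 Dy e0 e3 addrC.
have xy : mxof (x * y)%g = mxof 1%g.
  apply: eq_mx2; rewrite mxof1 !mxofE !Dy.
  - by rewrite e0 e2 u0 -dx2; ring.
  - by rewrite e1 e3 u1; ring.
  - by rewrite e0 e2 u2; ring.
  by rewrite e1 e3 u3 -dx2; ring.
by rewrite -[RHS](mulKg x) (mxof_inj xy) mulg1.
Qed.

(* With [theta] an eigenvalue of the companion matrix [c], [x = a + b c] acts by
   [a + b theta] on an eigenvector: this embeds the centralizer into the
   multiplicative group of a field, and the trace of [x] determines the eigenvalue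
   up to inversion. *)
Lemma companion_torus t c : mxof c = companion t -> t != 0 ->
  odd #|'C_G[c]%g| -> inverting_torus G 'C_G[c]%G.
Proof.
move=> Dc nzt oddC.
have [K [iota _]] := countable_algebraic_closure F.
have iota2 : iota 2%:R = 0 by have /andP[_ /eqP->] := pchar2; rewrite rmorph0.
have [theta Dtheta] : exists theta, theta ^+ 2 = iota t * theta - 1.
  have [|theta] := @solve_monicpoly K 2 (fun i => if i == 0%N then -1 else iota t); first by [].
  by rewrite big_ord_recl big_ord1 /= expr0 mulr1 expr1 addrC => E; exists theta.
pose f x := iota (mxof x 0 0) + iota (mxof x 0 1) * theta.
have fM : {in 'C_G[c]%g &, {morph f : x y / (x * y)%g >-> x * y}}.
  move=> x y /(cent1_companionP Dc)[_ x10 x11] /(cent1_companionP Dc)[_ y10 y11].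
  rewrite /f !mxofE y10 y11 !(rmorphD, rmorphM, rmorphN) /=.
  by ring: Dtheta.
have f_norm x : x \in 'C_G[c]%g ->
    iota (mxof x 0 0) ^+ 2 = 1 - iota (mxof x 0 0) * iota (mxof x 0 1) * iota t
      - iota (mxof x 0 1) ^+ 2.
  move=> /(det_cent1_companion Dc) /(congr1 iota).
  rewrite /nform !(rmorphD, rmorphM, rmorphXn, rmorph1) /= => <-; ring.
have f1 x : x \in 'C_G[c]%g -> f x = 1 <-> x = 1%g.
  move=> Cx; split=> [fx1 | ->]; last by rewrite /f mxof1 !mxE /= rmorph1 rmorph0 mul0r addr0.
  apply/eqP; apply: contraT => ntx.
  have nzb : mxof x 0 1 != 0 by apply: (cent1_companion_nontriv Dc); apply/setD1P.
  have Da : iota (mxof x 0 0) = 1 - iota (mxof x 0 1) * theta by rewrite -fx1 /f addrK.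
  have := f_norm x Cx; rewrite Da => E.
  (* Substituting a = 1 - b theta into the norm equation leaves b t = 2 b theta, which is 0 in
     characteristic 2; as [t] is nonzero, b = 0. *)
  have : iota (mxof x 0 1 * t) = iota 2%:R * iota (mxof x 0 1) * theta.
    rewrite rmorphM rmorph_nat; apply/eqP; rewrite -subr_eq0; apply/eqP.
    have := subrr ((1 - iota (mxof x 0 1) * theta) ^+ 2); rewrite {2}E => <-.
    by ring: Dtheta.
  rewrite iota2 !mul0r => /eqP; rewrite fmorph_eq0 mulf_eq0 (negPf nzb) (negPf nzt).
  by [].
have f_char x : x \in 'C_G[c]%g -> f x ^+ 2 = iota (\tr (mxof x)) * f x - 1.
  move=> Cx; have [_ x10 x11] := cent1_companionP Dc _ Cx.
  have := f_norm x Cx => E.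
  rewrite mxtrace2 x11 /f !(rmorphD, rmorphM) /=.
  by ring: Dtheta E.
have f_inj x y : x \in 'C_G[c]%g -> y \in 'C_G[c]%g -> f x * f y = 1 -> x = y^-1%g.
  move=> Cx Cy; rewrite -fM // => /(f1 _ (groupM Cx Cy)) xy1.
  by rewrite -[LHS](mulgK y) xy1 mul1g.
split.
- exact: subsetIl.
- exact: (field_mul_group_cyclic (f := f)).
- exact: oddC.
- exact: (cent1_cent1_companion Dc).
- move=> x y Cx Gy Cxy.
  have := f_char _ Cxy; rewrite mxtraceJ_SL2 => fz.
  have := f_char _ Cx => fx.
  have CV := groupVr Cx.
  have fV : f x * f x^-1%g = 1 by rewrite -fM // mulgV; apply/f1.
  (* Both values are roots of the same characteristic polynomial, whose roots have product 1. *)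
  have : (f (x ^ y)%g - f x) * (f (x ^ y)%g + f x - iota (\tr (mxof x))) = 0.
    by ring: fz fx.
  move/eqP; rewrite mulf_eq0 => /orP[/eqP E | /eqP E]; [left | right].
    rewrite -[RHS]invgK; apply: (f_inj _ _ Cxy CV).
    by rewrite -fV; congr (_ * _); apply/eqP; rewrite -subr_eq0 E.
  apply: (f_inj _ _ Cxy Cx).
  have -> : f (x ^ y)%g = iota (\tr (mxof x)) - f x by rewrite -[LHS]subr0 -E; ring.
  by ring: fx.
move=> x Cx; have [-> | ntx] := eqVneq x 1%g.
  by exists 1%g; rewrite ?group1 // conjg1 invg1.
have Gx : x \in G by case/setIP: Cx.
have : x^-1%g \in x ^: G.
  by apply: eq_SL2_trace; rewrite ?groupV ?invg_eq1 // mxtraceV_SL2.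
by case/imsetP=> y Gy ->; exists y.
Qed.

(** As square roots exist and are unique, an invertible matrix is in a unique way a nonzero scalar
    times a matrix of determinant 1; the order of GL_2 gives the rest. *)
Lemma card_SL2 : #|G| = (#|F| * (#|F| ^ 2 - 1))%N.
Proof.
pose q := #|F|; have q_gt1 : (1 < q)%N by rewrite /q cardF -{1}(expn0 2) ltn_exp2l.
have cardG : #|G| = #|[set A : 'M[F]_2 | \det A == 1]|.
  rewrite -(card_imset _ mxof_inj); apply: eq_card => A; rewrite inE.
  apply/imsetP/eqP=> [[x /SL2P dx ->] // | /SL2_exists[x Gx <-]]; by exists x.
have cardGL : #|'GL_2[F]| = #|[set A : 'M[F]_2 | \det A != 0]|.
  rewrite -(card_imset _ mxof_inj); apply: eq_card => A; rewrite inE.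
  apply/imsetP/idP=> [[x _ ->] | nzA].
    apply/eqP=> dx; have := congr1 determinant (mxofM x x^-1%g).
    by rewrite mulgV mxof1 det1 det_mulmx dx mul0r => /eqP; rewrite oner_eq0.
  have uA : (A : 'M[F]_2.-1.+1) \in unitmx by rewrite unitmxE unitfE.
  by exists (FinRing.unit _ uA); rewrite ?inE.
have : #|'GL_2[F]| = ((q - 1) * #|G|)%N.
  rewrite cardGL cardG.
  have -> : ((q - 1) * #|[set A : 'M[F]_2 | \det A == 1%R]| =
             #|setX [set~ (0%R : F)] [set A : 'M[F]_2 | \det A == 1%R]|)%N.
    by rewrite cardsX cardsC1 subn1.
  rewrite -(card_in_imset (f := fun w : F * 'M[F]_2 => w.1 *: w.2)).
    apply: eq_card => A; rewrite inE; apply/idP/imsetP=> [nz | [[s B]]].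
      have [s Ds] := sqrt2 (\det A).
      have nzs : s != 0 by apply: contraNneq nz => s0; rewrite -Ds s0 expr0n.
      exists (s, s^-1 *: A); last by rewrite /= scalerA mulfV // scale1r.
      by rewrite !inE /= nzs detZ exprVn Ds mulVf ?eqxx.
    rewrite !inE /= => /andP[nzs /eqP dB] ->.
    by rewrite detZ dB mulr1 expf_eq0.
  move=> [s A] [s' B]; rewrite !inE /= => /andP[nzs /eqP dA] /andP[nzs' /eqP dB] E.
  have ss' : s = s'.
    by apply: sqr_inj2; rewrite -[s ^+ 2]mulr1 -dA -detZ E detZ dB mulr1.
  by rewrite -ss' in E *; rewrite -[A](scalerK nzs) E scalerK.
rewrite card_GL_2 -/q => E; apply/eqP; rewrite -(eqn_pmul2l (_ : (0 < q - 1)%N)) ?subn_gt0 //.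
rewrite -E; apply/eqP; case: q q_gt1 {E} => // p _; rewrite subn1 /=; nia.
Qed.

(** By [card_nform1] the centralizer of a companion matrix has order q + 1 minus the number of
    roots. Trace 0 has the single root 1 and gives [U]; a trace without roots gives [C]; for q > 2,
    a + a^-1 has the roots a and a^-1 and gives [T]. *)
Lemma SL2_sl2_like : exists U T C : {group {'GL_2[F]}}, sl2_like #|F| G U T C.
Proof.
pose q := #|F|; have q_gt1 : (1 < q)%N by rewrite /q cardF -{1}(expn0 2) ltn_exp2l.
have q_gt0 := ltnW q_gt1.
have evenq : odd q = false by rewrite /q cardF oddX gtn_eqF.
have oddq1 : odd (q + 1) by rewrite oddD evenq.
have oddq'1 : odd (q - 1) by rewrite oddB // evenq.
have ex_c t : exists2 c, c \in G & mxof c = companion t by apply/SL2_exists/det_companion.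
have [u Gu Du] := ex_c 0.
have cardH t c : mxof c = companion t -> (#|'C_G[c]%g| + #|roots2 t| = q + 1)%N.
  by move=> Dc; rewrite (card_cent1_companion Dc) card_nform1.
have cardU : #|'C_G[u]%g| = q.
  have := cardH 0 u Du; suff -> : roots2 0 = [set 1] by rewrite cards1 => /addIn.
  apply/setP=> x; rewrite !inE /nform mulr0 addr0 expr1n addr_eq0 oppx.
  by rewrite -[RHS](inj_eq sqr_inj2) expr1n.
have traceU x : x \in 'C_G[u]%g -> \tr (mxof x) = 0.
  by case/(cent1_companionP Du) => _ _ x11; rewrite mxtrace2 x11 mul0r addr0.
(* If every trace had a root, x + x^-1 would map the finite field onto itself and be injective; but
   it takes the value 0 at both 1 and 0, by the convention 0^-1 = 0. *)
have [tC noroot] : exists t, roots2 t = set0.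
  have [/existsP[t /eqP] | /existsPn all_t] := boolP [exists t, roots2 t == set0];
    first by exists t.
  have ex_root t : exists x : F, x + x^-1 == t.
    have /set0Pn[x] := all_t t; rewrite inE /nform mulr1 expr1n => /eqP x0.
    exists x; have nzx : x != 0.
      by apply: contra_eq_neq x0 => ->; rewrite expr0n mul0r !add0r oner_eq0.
    rewrite -subr_eq0 oppx; apply/eqP; apply: (mulfI nzx); rewrite mulr0 -x0.
    by rewrite !mulrDr mulfV // expr2; ring.
  pose h t := xchoose (ex_root t).
  have hK : cancel h (fun x : F => x + x^-1) by move=> t; apply/eqP/(xchooseP (ex_root t)).
  have inj := can_inj ((bij_can_sym (injF_bij (can_inj hK)) _).2 hK).
  have /eqP : (0 : F) = 1 by apply: inj; rewrite invr0 invr1 addr0 addxx.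
  by rewrite eq_sym oner_eq0.
have nztC : tC != 0.
  apply: contraT => /negPn/eqP t0; have : (1 : F) \in roots2 tC.
    by rewrite inE /nform t0 mulr0 addr0 expr1n addxx.
  by rewrite noroot inE.
have [c Gc Dc] := ex_c tC.
have cardC : #|'C_G[c]%g| = (q + 1)%N by rewrite -(cardH tC c Dc) noroot cards0 addn0.
have torC : inverting_torus G 'C_G[c]%G.
  by apply: companion_torus Dc nztC _; rewrite cardC.
have [T cardT torT] : exists2 T : {group {'GL_2[F]}}, #|T| = (q - 1)%N & inverting_torus G T.
  (* For q = 2 no [a] differs from 0 and 1, and the torus of order q - 1 is the trivial group. *)
  have [q2 | neq2] := eqVneq q 2.
    exists 1%G; first by rewrite cards1 q2.
    split; rewrite ?sub1G ?cyclic1 ?cards1 //.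
    - by move=> x; rewrite setDv inE.
    - by move=> x y /set1P-> _ _; rewrite conj1g; left.
    - by move=> x /set1P->; exists 1%g; rewrite ?group1 // conjg1 invg1.
  have [a nza nea] : exists2 a : F, a != 0 & a != 1.
    have /subsetPn[a _] : ~~ ([set: F] \subset [set 0; 1]).
      apply/negP=> /subset_leq_card; rewrite cardsT cards2 -/q; case: eqP; lia.
    by rewrite !inE negb_or => /andP[nza nea]; exists a.
  pose t := a + a^-1.
  have aV : a != a^-1.
    apply: contra nea => /eqP aV; rewrite -(inj_eq sqr_inj2) expr1n expr2 {2}aV.
    by rewrite mulfV.
  have nzt : t != 0 by rewrite addr_eq0 oppx.
  have rootsT : roots2 t = [set a; a^-1].
    apply/setP=> x; rewrite !inE -(subr_eq0 x a) -(subr_eq0 x a^-1) -mulf_eq0 !oppx.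
    congr (_ == 0); rewrite /nform /t; field; done.
  have [g Gg Dg] := ex_c t; have := cardH t g Dg; rewrite rootsT cards2 aV => cardT.
  have {}cardT : #|'C_G[g]%g| = (q - 1)%N by rewrite -(addnK 2 #|'C_G[g]%g|) cardT addn1 subSS.
  by exists 'C_G[g]%G => //; apply: companion_torus Dg nzt _; rewrite cardT.
exists 'C_G[u]%G, T, 'C_G[c]%G; split=> //.
- exact: card_SL2.
- exact: subsetIl.
- move=> x Cx; have [_ x10 x11] := cent1_companionP Du _ Cx.
  have := det_cent1_companion Du Cx; rewrite /nform mulr0 addr0 => nx.
  have [u0 u1 u2 u3] := mx2_1E F.
  apply: mxof_inj; apply: eq_mx2; rewrite expgS expg1 mxof1 !mxofE ?x10 ?x11 ?u0 ?u1 ?u2 ?u3.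
  + by rewrite -nx mulrN oppx !expr2.
  + by rewrite mul0r addr0 mulrC addxx.
  + by rewrite mul0r addr0 [_ * - _]mulrC addxx.
  by rewrite mul0r addr0 -nx mulNr oppx !expr2 addrC.
- exact: (cent1_cent1_companion Du).
move=> x y /setD1P[ntx Cx] /setD1P[nty Cy].
apply: eq_SL2_trace => //; last by rewrite !traceU.
  by case/setIP: Cx.
by case/setIP: Cy.
Qed.

End Char2.

(** * Passage to PSL_2 *)

Section Transfer.
Variables (aT rT : finGroupType) (D : {group aT}) (f : {morphism D >-> rT}).
Hypothesis injf : 'injm f.
Implicit Types G H : {group aT}.

Lemma mem_morphim_inj H x : H \subset D -> x \in D -> (f x \in f @* H) = (x \in H).
Proof.
move=> sHD Dx; apply/idP/idP=> [/morphimP[y Dy Hy /(injmP injf)->] // | Hx].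
exact: mem_morphim.
Qed.

Lemma morphim_cent1 G H : G \subset D -> H \subset G ->
  {in H^#, forall x, 'C_G[x] = H} -> {in (f @* H)^#, forall x, 'C_(f @* G)[x] = f @* H}.
Proof.
move=> sGD sHG cH x /setD1P[ntx /morphimP[a Da Ha Dx]].
rewrite Dx -injm_subcent1 // cH // !inE Ha andbT.
by apply: contra ntx => /eqP a1; rewrite Dx a1 morph1.
Qed.

Lemma morphim_torus G H : G \subset D -> inverting_torus G H ->
  inverting_torus (f @* G)%G (f @* H)%G.
Proof.
move=> sGD [sHG cycH oddH cH conjH invH]; have sHD := subset_trans sHG sGD.
split.
- exact: morphimS.
- exact: morphim_cyclic.
- by rewrite card_injm.
- exact: morphim_cent1.
- move=> _ _ /morphimP[a Da Ha ->] /morphimP[b Db Gb ->].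
  have Dab : (a ^ b)%g \in D by rewrite groupJ.
  rewrite -morphJ // mem_morphim_inj // => Hab.
  by have [-> | ->] := conjH a b Ha Gb Hab; [left | right; rewrite morphV].
move=> _ /morphimP[a Da Ha ->]; have [b Gb Dab] := invH a Ha.
have Db := subsetP sGD b Gb.
by exists (f b); rewrite ?mem_morphim // -morphJ // Dab morphV.
Qed.

Lemma morphim_sl2_like q G U T C : G \subset D -> sl2_like q G U T C ->
  sl2_like q (f @* G)%G (f @* U)%G (f @* T)%G (f @* C)%G.
Proof.
move=> sGD [q_gt1 cG cU cT cC sUG expU centU conjU torT torC].
have sUD := subset_trans sUG sGD.
have sTD := subset_trans (torus_sub torT) sGD; have sCD := subset_trans (torus_sub torC) sGD.
split; rewrite ?card_injm //.
- exact: morphimS.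
- by move=> _ /morphimP[a Da Ua ->]; rewrite -morphX // expU // morph1.
- exact: morphim_cent1.
- move=> x y /setD1P[ntx /morphimP[a Da Ua Dx]] /setD1P[nty /morphimP[b Db Ub Dy]].
  have nta : a \in U^#.
    by rewrite !inE Ua andbT; apply: contra ntx => /eqP a1; rewrite Dx a1 morph1.
  have ntb : b \in U^#.
    by rewrite !inE Ub andbT; apply: contra nty => /eqP b1; rewrite Dy b1 morph1.
  have /imsetP[g Gg Db'] := conjU a b nta ntb; have Dg := subsetP sGD g Gg.
  by apply/imsetP; exists (f g); rewrite ?mem_morphim // Dx Dy Db' morphJ.
- exact: morphim_torus.
exact: morphim_torus.
Qed.

End Transfer.

(** The center lies in the centralizers [U] and [C] of nontrivial elements, whose orders q and q + 1
    are coprime. *)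
Lemma sl2_like_center q (gT : finGroupType) (G U T C : {group gT}) :
  sl2_like q G U T C -> 'Z(G) = 1%g.
Proof.
move=> slG; have q_gt1 := sl2_q slG.
have nontriv (H : {group gT}) : (1 < #|H|)%N -> exists x, x \in H^#.
  by rewrite cardG_gt1 => /trivgPn[x Hx ntx]; exists x; rewrite !inE ntx.
have [|x Ux] := nontriv U; first by rewrite (sl2_cardU slG).
have [|y Cy] := nontriv C; first by rewrite (sl2_cardC slG) addn1 ltnS ltnW.
have UC : U :&: C = 1%g.
  by apply: coprime_TIg; rewrite (sl2_cardU slG) (sl2_cardC slG) addn1 coprimenS.
apply/trivgP; rewrite -UC subsetI -{1}(sl2_centU slG Ux) -(torus_cent1 (sl2_C slG) Cy).
rewrite !subsetI center_sub /=; apply/andP; split; apply/subsetP=> z /centerP[_ cz];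
  apply/cent1P; apply: cz.
  by have [_] := setD1P Ux; apply: subsetP (sl2_U slG) x.
by have [_] := setD1P Cy; apply: subsetP (torus_sub (sl2_C slG)) y.
Qed.

Lemma PSL2_sl2_like (F : finFieldType) k : (0 < k)%N -> #|F| = (2 ^ k)%N ->
  exists U T C : {group coset_of 'Z(SL2 F)}, sl2_like #|F| (PSL2 F) U T C.
Proof.
move=> k_gt0 cardF; have [U [T [C slG]]] := SL2_sl2_like k_gt0 cardF.
have Z1 : 'Z(SL2 F)%g = 1%g := sl2_like_center slG.
have inj : 'injm (coset 'Z(SL2 F)) by rewrite ker_coset /= Z1.
have sGN : SL2_group F \subset 'N('Z(SL2 F)) by rewrite Z1 norm1 subsetT.
have -> : PSL2 F = (coset_morphism 'Z(SL2 F) @* SL2_group F)%G by apply: group_inj.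
by have := morphim_sl2_like inj sGN slG; eexists; eexists; eexists; eassumption.
Qed.

(* In (3) and (4), "for each d a unique simple module, pairwise non-isomorphic
   for distinct d" is read as: the simple modules of these dimensions are, up
   to isomorphism, exactly one for each index d.  Uniqueness by the dimension
   alone fails, since phi is not injective (q = 64: phi 7 = phi 9, with 7 and 9
   in B).  In (3) the module of (1) has to be set apart, since it has
   dimension (q - 1) / 2 * phi 3 = 1 when q = 2. *)
Theorem lemma3p3 (q k : nat) (F : finFieldType)
    (hk : (0 < k)%N) (hq : q = (2 ^ k)%N) (hF : #|F| = q) :
  (* (1) *)
  (exists M : QGmodule (PSL2 F),
     [/\ qtrivial M, qdim M = 1%N
       & forall N : QGmodule (PSL2 F),
           qtrivial N -> qdim N = 1%N -> qiso N M])
  /\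
  (* (2) *)
  (exists M : QGmodule (PSL2 F),
     [/\ steinberg_module q M, qdim M = q
       & forall N : QGmodule (PSL2 F), steinberg_module q N -> qiso N M])
  /\
  (* (3) *)
  (exists V : nat -> QGmodule (PSL2 F),
     [/\ forall d, d \in setA q ->
           qsimple (V d) /\ (qdim (V d))%:R = dimA q d,
         forall d d', d \in setA q -> d' \in setA q ->
           qiso (V d) (V d') -> d = d'
       & forall d (M : QGmodule (PSL2 F)), d \in setA q ->
           qsimple M -> (qdim M)%:R = dimA q d ->
           qtrivial M \/ (exists2 d', d' \in setA q & qiso M (V d'))])
  /\
  (* (4) *)
  (exists W : nat -> QGmodule (PSL2 F),
     [/\ forall d, d \in setB q ->
           qsimple (W d) /\ (qdim (W d))%:R = dimB q d,
         forall d d', d \in setB q -> d' \in setB q ->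
           qiso (W d) (W d') -> d = d'
       & forall d (M : QGmodule (PSL2 F)), d \in setB q ->
           qsimple M -> (qdim M)%:R = dimB q d ->
           exists2 d', d' \in setB q & qiso M (W d')])
  /\
  (* (5) *)
  (exists s : seq 'CF(PSL2 F),
     [/\ uniq s, forall chi, (chi \in s) <-> Irr_rat chi
       & size s = (tau (q - 1) + tau (q + 1))%N]).
Proof.
have cardF : #|F| = (2 ^ k)%N by rewrite hF.
have [U [T [C]]] := PSL2_sl2_like hk cardF; rewrite hF => slG.
exact: sl2_like_classification slG.
Qed.
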